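(* Let $G$ be a countable infinite discrete Abelian group and let $T=(T_g)_{g\in G}$ be the $(C,F)$-action of $G$ associated with a sequence $(C_n,F_{n-1})_{n\ge1}$ satisfying (I)–(III), such that $0\in\bigcap_{n>0}F_n$ and for each $g\in G$ and $n>0$ there is $m>n$ with $g+F_n+C_{n+1}+\cdots+C_m\subset F_m$. Let $\mu$ be the $(C,F)$-measure with $\mu([0]_0)=1$. Suppose that: (1) one of the following (equivalent) conditions holds: (i) for all cylinders $A,B\subset[0]_0$, $\displaystyle\lim_{n\to\infty}\frac{\sum_{g\in F_n-F_n}\mu(A\cap T_gB)}{\sum_{g\in F_n-F_n}\mu([0]_0\cap T_g[0]_0)}=\mu(A)\mu(B)$; (ii) for each $l>0$ and each $h\in F_l-F_l$, the ratio of $\sum_{g\in F_n-F_n+h}\mu([0]_l\cap T_g[0]_l)$ to $\sum_{g\in F_n-F_n}\mu([0]_l\cap T_g[0]_l)$ tends to $1$ as $n\to\infty$; (iii) for each $l>0$ and each $h\in F_l-F_l$, $$\lim_{n\to\infty}\lim_{L\to\infty}\frac{\nu_{C_{l+1}+\cdots+C_L}*\nu_{-C_{l+1}-\cdots-C_L}(F_n-F_n)}{\nu_{C_{l+1}+\cdots+C_L}*\nu_{-C_{l+1}-\cdots-C_L}(F_n-F_n+h)}=1;$$ (2) there is $K>0$ such that for every $n$, $F_n-F_n\subset\bigsqcup_{j=1}^K(d_{n,j}+F_n)$ for some $d_{n,1},\dots,d_{n,K}\in G$. Then $$\lim_{n\to\infty}\frac{\sum_{g\in F_n-F_n}\mu(A\cap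 T_gB)}{\sum_{g\in F_n-F_n}\mu([0]_0\cap T_g[0]_0)}=\mu(A)\mu(B)$$ for all Borel subsets $A,B\subset[0]_0$. Hence $T$ is weakly rationally ergodic along the sequence $(F_n-F_n)_{n\ge0}$. In particular, $T$ is non-squashable.
   Context: **$(C,F)$-construction (Abelian group $G$, additive notation).** Let $(F_n)_{n\ge0}$, $(C_n)_{n\ge1}$ be finite subsets of $G$ with: (I) $F_0=\{0\}$, $\#C_n>1$; (II) $F_n+C_{n+1}\subset F_{n+1}$; (III) $(F_n+c)\cap(F_n+c')=\emptyset$ for distinct $c,c'\in C_{n+1}$. Put $X_n=F_n\times C_{n+1}\times C_{n+2}\times\cdots$ (product topology), embed $X_n$ into $X_{n+1}$ by $(f_n,c_{n+1},c_{n+2},\dots)\mapsto(f_n+c_{n+1},c_{n+2},\dots)$, and let $X=\bigcup_nX_n$ be the topological inductive limit. For $A\subset F_n$ the set $[A]_n=\{(f_n,c_{n+1},\dots)\in X_n: f_n\in A\}$ is called a cylinder; $[f]_n=[\{f\}]_n$. The $(C,F)$-measure is the Radon measure with $\mu([A]_n)=\#A/(\#C_1\cdots\#C_n)$. The $(C,F)$-action is: for $x=(f_n,c_{n+1},\dots)\in X_n$ with $g+f_n\in F_n$, $T_gx=(g+f_n,c_{n+1},\dots)$; under the assumptions of the claim it is defined on all of $X$ and preserves $\mu$. For a finite set $D\subset G$, $\nu_D=\sum_{g\in D}\delta_g$ ($\delta_g$ the unit point mass at $g$); $*$ is convolution. $A\pm B=\{a\pm b:a\in A,b\in B\}$. **Weak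 rational ergodicity.** Let $T$ be an ergodic conservative measure preserving action of an amenable group $G$ on a $\sigma$-finite measure space $(X,\mathfrak B,\mu)$ and let $(E_n)_{n\ge0}$ be an increasing Følner sequence in $G$. $T$ is called weakly rationally ergodic along $(E_n)_{n\ge0}$ if there is a subset $Y$ of finite positive measure such that $\lim_{n\to\infty}\frac1{a_n(Y)}\sum_{g\in E_n}\mu(A\cap T_gB)=\mu(A)\mu(B)$ for all measurable $A,B\subset Y$, where $a_n(Y)=\sum_{g\in E_n}\mu(Y\cap T_gY)/\mu(Y)^2$. **Non-squashable**: every nonsingular transformation commuting with the action $T$ preserves $\mu$.
   Formalization: Weak rational ergodicity along (F_n-F_n) is proved without the clause that (F_n-F_n) is a Følner sequence, since the hypotheses do not imply it (there are counterexamples in Z); every other part of that notion, including ''increasing'', is proved. *)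

(* Defs.v *)
From HB Require Import structures.
From mathcomp Require Import all_boot all_order all_algebra finmap.
From mathcomp Require Import all_classical all_reals all_analysis.

Set Implicit Arguments.
Unset Strict Implicit.
Unset Printing Implicit Defensive.

Import Order.TTheory GRing.Theory Num.Theory.
Import numFieldNormedType.Exports.

Local Open Scope classical_set_scope.
Local Open Scope ring_scope.

Section FiniteSubsets.
Context {G : countZmodType}.
Implicit Types (A B : {fset G}) (g : G).

Definition sumset A B : {fset G} := [fset (a + b)%R | a in A, b in B]%fset.
Definition diffset A B : {fset G} := [fset (a - b)%R | a in A, b in B]%fset.
Definition oppset A : {fset G} := [fset (- a)%R | a in A]%fset.
Definition translate g A : {fset G} := [fset (g + a)%R | a in A]%fset.

End FiniteSubsets.

(* A finitely supported measure on the discrete group G is represented by its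
   mass function; the sums over sets below have finite support. *)
Section FinitelySupportedMeasures.
Context {R : realType} {G : countZmodType}.

Definition point_mass (g : G) : G -> R := fun x => (x == g)%:R.

Definition nu (D : {fset G}) : G -> R :=
  fun x => \sum_(g <- D) point_mass g x.

Definition convolution (p q : G -> R) : G -> R :=
  fun x => \sum_(y \in [set: G]) p y * q (x - y).

Definition mass (p : G -> R) (E : {fset G}) : R := \sum_(x <- E) p x.

End FinitelySupportedMeasures.

(* The sequence C is only meaningful from index 1 on; [cfC 0] is not used. *)
Record cf_sequence (G : countZmodType) := CFSequence {
  cfF : nat -> {fset G};
  cfC : nat -> {fset G};
  cfF0 : cfF 0 = [fset 0]%fset;
  cfC_gt1 : forall n, (1 < #|` cfC n.+1|)%N;
  cfFC_sub : forall n, (sumset (cfF n) (cfC n.+1) `<=` cfF n.+1)%fset;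
  cfFC_disj : forall n c c', c \in cfC n.+1 -> c' \in cfC n.+1 -> c != c' ->
    [disjoint translate c (cfF n) & translate c' (cfF n)]%fset }.

Section CFSpace.
Context {G : countZmodType} (S : cf_sequence G).

(* C_{l+1} + ... + C_m, which is {0} when m <= l *)
Definition cfCsum (l m : nat) : {fset G} :=
  \big[sumset/[fset 0]%fset]_(l.+1 <= k < m.+1) cfC S k.

(* X_n = F_n x C_{n+1} x C_{n+2} x ..., inside G^nat: coordinate 0 lies in F_n
   and coordinate k > 0 lies in C_{n+k}. *)
Definition cf_level (n : nat) : set (prod_topology (fun _ : nat => discrete_topology G)) :=
  [set x | (x 0%N : G) \in cfF S n /\
           forall k, (x k.+1 : G) \in cfC S (n + k.+1)].

(* disjoint union of the X_n, with the sum topology *)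
Definition cf_rep : Type := {n : nat & cf_level n}.
HB.instance Definition _ := Topological.on cf_rep.

Definition cf_shift (x : nat -> G) : nat -> G :=
  fun k => if k is 0 then x 0%N + x 1%N else x k.+1.

(* The embedding of X_n into X_{n+1} is [cf_shift]; two points are identified
   in the inductive limit when their images in some X_p coincide. *)
Definition cf_eqv_prop (u v : cf_rep) : Prop :=
  exists i j, (tag u + i = tag v + j)%N /\
    iter i cf_shift (val (tagged u)) = iter j cf_shift (val (tagged v)).

Definition cf_eqv (u v : cf_rep) : bool := `[< cf_eqv_prop u v >].

Lemma cf_eqv_refl : reflexive cf_eqv.
Proof. by move=> u; apply/asboolP; exists 0%N, 0%N. Qed.

Lemma cf_eqv_sym : symmetric cf_eqv.
Proof.
by move=> u v; apply/asboolP/asboolP => -[i [j [e1 e2]]]; exists j, i.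
Qed.

Lemma cf_eqv_trans : transitive cf_eqv.
Proof.
move=> v u w /asboolP[i [j [e1 e2]]] /asboolP[i' [j' [e3 e4]]].
apply/asboolP; exists (i' + i)%N, (j + j')%N; split.
  by rewrite [(i' + i)%N]addnC addnA e1 addnAC e3 -addnA [(j' + j)%N]addnC.
by rewrite !iterD e2 -e4 -!iterD addnC.
Qed.

Canonical cf_equiv_rel := EquivRel cf_eqv cf_eqv_refl cf_eqv_sym cf_eqv_trans.

Definition cf_space : Type := quotient_topology {eq_quot cf_equiv_rel}%qT.
HB.instance Definition _ := Topological.on cf_space.

Definition cf_in (n : nat) (x : cf_level n) : cf_space :=
  (\pi_(quotient_topology {eq_quot cf_equiv_rel}) (existT _ n x : cf_rep))%qT.

Lemma cf_level0_nonempty : exists x, x \in cf_level 0.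
Proof.
have /choice[c cC] : forall k, exists c, c \in cfC S k.+1.
  move=> k; have := cfC_gt1 S k.
  by case: (fset_0Vmem (cfC S k.+1)) => [->|[c ?] _]; [rewrite cardfs0|exists c].
exists (fun k => if k is k'.+1 then c k' else 0).
apply/mem_set; split=> [|k]; last by rewrite add0n; exact: cC.
by rewrite cfF0 inE.
Qed.

Definition cf_point : cf_space :=
  cf_in (exist _ _ (projT2 (cid cf_level0_nonempty)) : cf_level 0).

HB.instance Definition _ := isPointed.Build cf_space cf_point.

(* Borel sigma-algebra *)
HB.instance Definition _ :=
  Measurable.copy cf_space (g_sigma_algebraType (@open cf_space)).

Definition cylinder (n : nat) (A : {fset G}) : set cf_space :=
  [set cf_in x | x in [set x : cf_level n | (val x 0%N : G) \in A]].

(* T_g (f_n, c_{n+1}, ...) = (g + f_n, c_{n+1}, ...) whenever g + f_n lies in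
   F_n for some representation of the point; a point without any such
   representation is left fixed. *)
Definition cf_action (g : G) (x : cf_space) : cf_space :=
  xget x [set y | exists n (u v : cf_level n),
    [/\ x = cf_in u, y = cf_in v, (val v 0%N : G) = g + val u 0%N &
        forall k, val v k.+1 = val u k.+1]].

Context {R : realType}.

Definition radon (mu : {measure set cf_space -> \bar R}) : Prop :=
  (forall K : set cf_space, compact K -> (mu K < +oo)%E) /\
  (forall B : set cf_space, measurable B ->
    mu B = ereal_sup [set mu K | K in [set K | compact K /\ K `<=` B]]).

Definition cf_measure (mu : {measure set cf_space -> \bar R}) : Prop :=
  radon mu /\
  forall n (A : {fset G}), (A `<=` cfF S n)%fset ->
    mu (cylinder n A) =
      (#|` A|%:R / \prod_(1 <= k < n.+1) #|` cfC S k|%:R)%:E.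

End CFSpace.

Arguments cylinder {G} S n A.
Arguments cf_action {G} S g x.

Section Actions.
Context {R : realType} {G : countZmodType} {d : measure_display}
  {X : measurableType d}.
Variables (mu : {measure set X -> \bar R}) (T : G -> X -> X).

Definition mp_action : Prop :=
  [/\ forall x, T 0 x = x,
      forall g h x, T (g + h) x = T g (T h x),
      forall g, measurable_fun setT (T g) &
      forall g A, measurable A -> mu (T g @^-1` A) = mu A].

Definition ergodic : Prop :=
  forall A, measurable A -> (forall g, T g @^-1` A = A) ->
    mu A = 0%E \/ mu (~` A) = 0%E.

Definition conservative : Prop :=
  forall A, measurable A -> (0 < mu A)%E ->
    exists2 g, g != 0 & (0 < mu (A `&` T g @` A))%E.

(* only used for sets A, B one of which has finite measure, so that all the
   terms are finite *)
Definition return_sum (E : {fset G}) (A B : set X) : R :=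
  \sum_(g <- E) fine (mu (A `&` T g @` B)).

(* The standing assumptions on the action are part of the definition. The
   sequence E is usually also taken to be Folner; this involves E and G only,
   and it does not follow from the hypotheses under which the definition is used
   below for E n = F_n - F_n, so it is not imposed here. *)
Definition weakly_rationally_ergodic (E : nat -> {fset G}) : Prop :=
  [/\ sigma_finite setT mu, mp_action, ergodic, conservative &
      forall n, (E n `<=` E n.+1)%fset] /\
  exists Y : set X,
    [/\ measurable Y, (0 < mu Y)%E, (mu Y < +oo)%E &
        forall A B : set X, measurable A -> measurable B ->
          A `<=` Y -> B `<=` Y ->
          let a n := return_sum (E n) Y Y / fine (mu Y) ^+ 2 in
          (a n)^-1 * return_sum (E n) A B @[n --> \oo]
            --> fine (mu A) * fine (mu B)].

Definition nonsingular (Q : X -> X) : Prop :=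
  measurable_fun setT Q /\
  forall N, measurable N -> (mu (Q @^-1` N) = 0%E <-> mu N = 0%E).

Definition non_squashable : Prop :=
  forall Q : X -> X, nonsingular Q ->
    (forall g, {ae mu, forall x, Q (T g x) = T g (Q x)}) ->
    forall B, measurable B -> mu (Q @^-1` B) = mu B.

End Actions.

Section Conditions.
Context {R : realType} {G : countZmodType} (S : cf_sequence G)
  (mu : {measure set (cf_space S) -> \bar R}).

Let T := cf_action S.
Let F := cfF S.
Let FF (n : nat) := diffset (F n) (F n).

Definition cyl0 (l : nat) : set (cf_space S) := cylinder S l [fset 0]%fset.

Definition is_cylinder (A : set (cf_space S)) : Prop :=
  exists n (B : {fset G}), (B `<=` F n)%fset /\ A = cylinder S n B.

Definition return_ratio (A B : set (cf_space S)) (n : nat) : R :=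
  return_sum mu T (FF n) A B / return_sum mu T (FF n) (cyl0 0) (cyl0 0).

Definition condition_i : Prop :=
  forall A B, is_cylinder A -> is_cylinder B ->
    A `<=` cyl0 0 -> B `<=` cyl0 0 ->
    return_ratio A B n @[n --> \oo] --> fine (mu A) * fine (mu B).

Definition condition_ii : Prop :=
  forall l h, (0 < l)%N -> h \in FF l ->
    return_sum mu T (translate h (FF n)) (cyl0 l) (cyl0 l) /
      return_sum mu T (FF n) (cyl0 l) (cyl0 l) @[n --> \oo] --> (1 : R).

(* The inner limit exists for every n; its value b n is made explicit. *)
Definition condition_iii : Prop :=
  forall l h, (0 < l)%N -> h \in FF l ->
    let m L : G -> R :=
      convolution (nu (cfCsum S l L)) (nu (oppset (cfCsum S l L))) in
    exists b : nat -> R,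
      (forall n, mass (m L) (FF n) / mass (m L) (translate h (FF n))
                   @[L --> \oo] --> b n) /\
      b n @[n --> \oo] --> (1 : R).

Definition condition_2 : Prop :=
  exists2 K : nat, (0 < K)%N &
    forall n, exists d : 'I_K -> G,
      (forall i j, i != j ->
         [disjoint translate (d i) (F n) & translate (d j) (F n)]%fset) /\
      (forall g, g \in FF n -> exists j, g \in translate (d j) (F n)).

End Conditions.

Arguments cyl0 {G} S l.
Arguments condition_iii R {G} S.

(* Main.v *)
(* Let Y = [0]_0, E_n = F_n - F_n and alpha_n = #(C_1 + ... + C_n).  The number
   of g in E_n with T_g x in Y is at least alpha_n for every x in X_n, and at
   most K^2 alpha_n for every x, by (2).  Hence the normalised sums of
   mu(A /\ T_g B) over E_n are bounded by K^2 mu(A) and K^2 mu(B) on Borel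
   subsets of Y, uniformly in n, and the convergence passes from cylinders to
   Borel sets by Dynkin's lemma.  Condition (iii) is (ii) with the measures of
   the intersections written as limits of convolutions, and (ii) says that, for
   each l, all pairs of cylinders [a]_l, [a']_l in Y have asymptotically equal
   return sums.  Ergodicity and conservativity follow from the limit law on Y,
   since Y meets every orbit and alpha_n tends to infinity.

   For non-squashability let Q commute with T.  Summing
   mu(Y /\ Q^-1 T_g^-1 Y) = mu(Q^-1 Y /\ T_g Y) over g in E_n and using the
   pointwise bounds on both sides gives K^-2 <= mu(Q^-1 Y) <= K^2.  Up to
   scaling, mu is the only T-invariant measure with mu(Y) finite, so
   mu o Q^-1 = c mu; applying the bounds to the iterates of Q gives
   K^-2 <= c^k <= K^2 for all k, hence c = 1. *)
Require Import Defs.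
From mathcomp Require Import all_boot all_order all_algebra finmap.
From mathcomp Require Import all_classical all_reals all_analysis.
From mathcomp Require Import measurable_realfun lra.

Set Implicit Arguments.
Unset Strict Implicit.
Unset Printing Implicit Defensive.

Import Order.TTheory GRing.Theory Num.Theory.
Import numFieldNormedType.Exports.

Local Open Scope classical_set_scope.
Local Open Scope ring_scope.

(** * Points of the space and their representations *)

Section Representations.
Context {G : countZmodType} (S : cf_sequence G).
Notation F := (cfF S).
Notation C := (cfC S).
Implicit Types (x y : nat -> G) (p q : cf_space S) (n m : nat) (f g c : G).

Lemma cf_level1 n x : cf_level S n x -> x 1%N \in C n.+1.
Proof. by move=> [_ /(_ 0%N)]; rewrite addn1. Qed.

Lemma cf_shift_level n x :
  cf_level S n x -> cf_level S n.+1 (cf_shift x).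
Proof.
move=> [x0 xC]; split=> [|k] /=; last by rewrite addSnnS; exact: xC.
apply: (fsubsetP (cfFC_sub S n)); apply/imfset2P; exists (x 0%N) => //.
by exists (x 1%N) => //; exact: cf_level1.
Qed.

Lemma cfFC_inj n f f' c c' : f \in F n -> f' \in F n ->
  c \in C n.+1 -> c' \in C n.+1 -> f + c = f' + c' -> f = f' /\ c = c'.
Proof.
move=> fF f'F cC c'C e; have [cc'|cc'] := eqVneq c c'.
  by split=> //; move: e; rewrite cc' => /addIr.
have /fdisjointP/(_ (f + c)) := cfFC_disj cC c'C cc'.
have -> : f + c \in translate c (F n).
  by apply/imfsetP; exists f => //; rewrite addrC.
move=> /(_ isT); rewrite e => /negP[].
by apply/imfsetP; exists f' => //; rewrite addrC.
Qed.

(** By (III) the sum of the first two coordinates determines both of them, and the shift leaves all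
    later coordinates visible. *)
Lemma cf_shift_inj n x y : cf_level S n x -> cf_level S n y ->
  cf_shift x = cf_shift y -> x = y.
Proof.
move=> xn yn e.
have e0 : x 0%N + x 1%N = y 0%N + y 1%N := congr1 (@^~ 0%N) e.
have [ex ey] := cfFC_inj xn.1 yn.1 (cf_level1 xn) (cf_level1 yn) e0.
apply/funext => -[//|[//|k]].
exact: (congr1 (fun z : nat -> G => z k.+1) e).
Qed.

Lemma iter_cf_shift_level i n x :
  cf_level S n x -> cf_level S (n + i) (iter i cf_shift x).
Proof.
by move=> xn; elim: i => [|i ih]; rewrite ?addn0// addnS; exact: cf_shift_level.
Qed.

Lemma iter_cf_shift_inj i n x y : cf_level S n x -> cf_level S n y ->
  iter i cf_shift x = iter i cf_shift y -> x = y.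
Proof.
move=> xn yn; elim: i => [//|i ih] /= e; apply: ih.
by apply: (@cf_shift_inj (n + i)) e; exact: iter_cf_shift_level.
Qed.

(** A relation between plain sequences and points of the quotient, so that later arguments avoid
    subtypes and class representatives. A point need not have coordinates at every level, but when
    it has some at level [n] they are unique, and then it has some at all higher levels. *)
Definition cf_rep_of n x p := exists u : cf_level S n, val u = x /\ p = cf_in u.

Lemma cf_rep_of_level n x p : cf_rep_of n x p -> cf_level S n x.
Proof. by move=> [u [<- _]]; exact/set_mem/valP. Qed.

Lemma cf_in_eqP n m (u : cf_level S n) (v : cf_level S m) :
  cf_in u = cf_in v <->
  cf_eqv_prop (existT _ n u : cf_rep S) (existT _ m v : cf_rep S).
Proof.
split.
  move=> /(@eqquotP _ (cf_eqv (S := S)) {eq_quot cf_equiv_rel S}%qT).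
  by move=> /asboolP.
by move=> h; apply/(@eqquotP _ (cf_eqv (S := S)) {eq_quot cf_equiv_rel S}%qT);
  apply/asboolP.
Qed.

Lemma cf_rep_of_uniq n x y p : cf_rep_of n x p -> cf_rep_of n y p -> x = y.
Proof.
move=> [u [<- ->]] [v [<- /cf_in_eqP[i [j [/= /addnI -> e]]]]].
by apply: iter_cf_shift_inj e; exact/set_mem/valP.
Qed.

Lemma cf_rep_of_fun n x p q : cf_rep_of n x p -> cf_rep_of n x q -> p = q.
Proof. by move=> [u [<- ->]] [v [/val_inj -> ->]]. Qed.

Lemma cf_rep_of_level_ex n x : cf_level S n x -> exists p, cf_rep_of n x p.
Proof.
move=> xn; pose u : cf_level S n := exist _ x (mem_set xn).
by exists (cf_in u), u.
Qed.

Lemma cf_rep_of_shift n x p : cf_rep_of n x p -> cf_rep_of n.+1 (cf_shift x) p.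
Proof.
move=> [u [<- ->]].
have un : cf_level S n.+1 (cf_shift (val u)).
  by apply: cf_shift_level; exact/set_mem/valP.
exists (exist _ (cf_shift (val u)) (mem_set un)); split=> //.
by apply/cf_in_eqP; exists 1%N, 0%N; rewrite /= addn1 addn0.
Qed.

Lemma cf_rep_of_iter i n x p :
  cf_rep_of n x p -> cf_rep_of (n + i) (iter i cf_shift x) p.
Proof.
by move=> xp; elim: i => [|i ih]; rewrite ?addn0// addnS; exact: cf_rep_of_shift.
Qed.

Lemma cf_rep_of_ex p : exists n x, cf_rep_of n x p.
Proof.
by case: (repr p) (reprK p) => n u /= e; exists n, (val u), u; split.
Qed.

Lemma cf_rep_of_ext n x y p : cf_rep_of n x p -> x =1 y -> cf_rep_of n y p.
Proof. by move=> xp /funext <-. Qed.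

(** The sequence is [f, c, y 1, y 2, ...], whose shift is [y]; a decomposition of the head thus
    lowers the level by one. *)
Lemma cf_rep_of_unshift n y p f c : cf_rep_of n.+1 y p -> f \in F n ->
  c \in C n.+1 -> y 0%N = f + c ->
  cf_rep_of n (fun k => if k is k'.+1 then
                          if k' is 0%N then c else y k' else f) p.
Proof.
set x := (X in cf_rep_of n X) => yp fF cC y0.
have [y0F yC] := cf_rep_of_level yp.
have xn : cf_level S n x.
  split=> // -[|k] /=; first by rewrite addn1.
  by rewrite -addSnnS; exact: yC.
have [q xq] := cf_rep_of_level_ex xn.
suff <- : q = p by [].
apply: (cf_rep_of_fun (cf_rep_of_shift xq)); apply: (cf_rep_of_ext yp).
by case.
Qed.

Definition cyl n f : set (cf_space S) := cylinder S n [fset f]%fset.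

Lemma cylinderP n (A : {fset G}) p :
  cylinder S n A p <-> exists2 x, cf_rep_of n x p & x 0%N \in A.
Proof.
split.
  by move=> [u uA <-]; exists (val u) => //; exists u.
by move=> [x [u [<- ->]] x0]; exists u.
Qed.

Lemma cylP n f p : cyl n f p <-> exists2 x, cf_rep_of n x p & x 0%N = f.
Proof.
rewrite /cyl cylinderP.
by split=> -[x xp]; [rewrite inE => /eqP xf|move=> xf]; exists x; rewrite ?inE ?xf.
Qed.

Lemma cyl_mem n f p : cyl n f p -> f \in F n.
Proof. by move=> /cylP[x /cf_rep_of_level[x0 _] <-]. Qed.

Lemma cyl_uniq n f f' p : cyl n f p -> cyl n f' p -> f = f'.
Proof.
by move=> /cylP[x xp <-] /cylP[y yp <-]; rewrite (cf_rep_of_uniq xp yp).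
Qed.

Lemma cyl_refine1 n f p : cyl n f p ->
  exists2 c, c \in C n.+1 & cyl n.+1 (f + c) p.
Proof.
move=> /cylP[x xp <-].
exists (x 1%N); first exact/cf_level1/cf_rep_of_level/xp.
apply/cylP.
by exists (cf_shift x) => //; exact: cf_rep_of_shift.
Qed.

Lemma cyl_coarsen1 n f c p : f \in F n -> c \in C n.+1 ->
  cyl n.+1 (f + c) p -> cyl n f p.
Proof.
move=> fF cC /cylP[y yp y0]; apply/cylP; eexists.
  exact: (cf_rep_of_unshift yp fF cC y0).
by [].
Qed.

Lemma cyl_ex p : exists n f, cyl n f p.
Proof.
have [n [x xp]] := cf_rep_of_ex p.
by exists n, (x 0%N); apply/cylP; exists x.
Qed.

Lemma cyl_nonempty n f : f \in F n -> cyl n f !=set0.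
Proof.
move=> fF.
have /choice[c cC] : forall k, exists c, c \in C (n + k.+1).
  move=> k; have := cfC_gt1 S (n + k); rewrite addnS.
  by case: (fset_0Vmem (C (n + k).+1)) => [->|[c ?] _]; [rewrite cardfs0|exists c].
have [p xp] : exists p, cf_rep_of n (fun k => if k is k'.+1 then c k' else f) p.
  by apply: cf_rep_of_level_ex; split.
by exists p; apply/cylP; eexists; [exact: xp|].
Qed.

Lemma cfCsum_geq l m : (m <= l)%N -> cfCsum S l m = [fset 0]%fset.
Proof. by move=> ml; rewrite /cfCsum big_geq. Qed.

Lemma cfCsum_ltn l m : (l < m)%N ->
  cfCsum S l m = sumset (C l.+1) (cfCsum S l.+1 m).
Proof. by move=> lm; rewrite /cfCsum big_ltn. Qed.

Lemma cyl_refine l m f p : (l <= m)%N -> cyl l f p ->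
  exists2 c, c \in cfCsum S l m & cyl m (f + c) p.
Proof.
(* Induction on the number of levels with [l] general, since [cfCsum] is peeled off at its left
   end. *)
move=> /subnK <-; move: (m - l)%N => k; elim: k l f => [|k ih] l f.
  by move=> fp; exists 0; rewrite ?addr0// cfCsum_geq ?inE.
rewrite addSnnS => /cyl_refine1[c cC] /ih[c' c'C cp].
exists (c + c'); last by rewrite addrA.
rewrite cfCsum_ltn ?leq_addl//.
by apply/imfset2P; exists c => //; exists c'.
Qed.

Lemma cyl_coarsen l m f c p : (l <= m)%N -> f \in F l -> c \in cfCsum S l m ->
  cyl m (f + c) p -> cyl l f p.
Proof.
move=> /subnK <-; move: (m - l)%N => k; elim: k l f c => [|k ih] l f c.
  by move=> fF; rewrite cfCsum_geq // inE => /eqP ->; rewrite addr0.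
move=> fF; rewrite addSnnS cfCsum_ltn ?leq_addl//.
move=> /imfset2P[c1 /= c1C [c2 /= c2C ->]]; rewrite addrA => h.
apply: (@cyl_coarsen1 l f c1) => //.
apply: ih c2C h; apply: (fsubsetP (cfFC_sub S l)).
by apply/imfset2P; exists f => //; exists c1.
Qed.

Lemma cfCsum_FP l m f c : (l <= m)%N -> f \in F l -> c \in cfCsum S l m ->
  f + c \in F m.
Proof.
move=> /subnK <-; move: (m - l)%N => k; elim: k l f c => [|k ih] l f c.
  by move=> fF; rewrite cfCsum_geq // inE => /eqP ->; rewrite addr0.
move=> fF; rewrite addSnnS cfCsum_ltn ?leq_addl//.
move=> /imfset2P[c1 /= c1C [c2 /= c2C ->]]; rewrite addrA.
apply: ih => //.
apply: (fsubsetP (cfFC_sub S l)).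
by apply/imfset2P; exists f => //; exists c1.
Qed.

(** Cylinders that meet are nested: the common point forces [f' = f + c] with [c] in [cfCsum S l m],
    and any point with such a head coarsens to [f]. *)
Lemma cyl_sub l m f f' p : (l <= m)%N -> cyl l f p -> cyl m f' p ->
  cyl m f' `<=` cyl l f.
Proof.
move=> lm lp mp; have [c cC cp] := cyl_refine lm lp.
rewrite (cyl_uniq mp cp) => q; apply: cyl_coarsen => //.
exact: cyl_mem lp.
Qed.

Lemma cyl_level_ge l f p m : (l <= m)%N -> cyl l f p -> exists f', cyl m f' p.
Proof. by move=> lm /(cyl_refine lm)[c _ cp]; exists (f + c). Qed.

End Representations.

Arguments cyl {G} S n f _.

(** * The action *)

Section Action.
Context {G : countZmodType} (S : cf_sequence G).
Notation F := (cfF S).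
Notation C := (cfC S).
Notation T := (cf_action S).
Implicit Types (x y : nat -> G) (p q : cf_space S) (n m : nat) (f g h c : G).

Definition set_head (a : G) x : nat -> G :=
  fun k => if k is 0%N then a else x k.

Lemma cf_shift_set_head a x :
  cf_shift (set_head a x) = set_head (a + x 1%N) (cf_shift x).
Proof. by apply/funext => -[|k]. Qed.

(** The graph of the partially defined translation, from which [cf_action] selects by [xget]. *)
Definition cf_moves g p q := exists n x,
  cf_rep_of n x p /\ cf_rep_of n (set_head (g + x 0%N) x) q.

Lemma cf_movesP g p q : cf_moves g p q <->
  exists n (u v : cf_level S n),
    [/\ p = cf_in u, q = cf_in v, (val v 0%N : G) = g + val u 0%N &
        forall k, val v k.+1 = val u k.+1].
Proof.
split=> [[n [_ [[u [<- ->]] [v [vu ->]]]]]|[n [u [v [-> -> v0 vu]]]]].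
  by exists n, u, v; rewrite vu; split.
exists n, (val u); split; first by exists u.
by exists v; split=> //; apply/funext => -[|k].
Qed.

Lemma set_head_iter g i x :
  iter i cf_shift (set_head (g + x 0%N) x) =
  set_head (g + iter i cf_shift x 0%N) (iter i cf_shift x).
Proof.
elim: i => [//|i ih].
by rewrite iterS ih cf_shift_set_head -addrA.
Qed.

(** Both representations are shifted to the common level [n + m]; translating the head commutes with
    the shift. *)
Lemma cf_moves_fun g p q q' : cf_moves g p q -> cf_moves g p q' -> q = q'.
Proof.
move=> [n [x [xp xq]]] [m [y [yp yq]]].
have xp' := cf_rep_of_iter m xp; have yp' := cf_rep_of_iter n yp.
have xq' := cf_rep_of_iter m xq; have yq' := cf_rep_of_iter n yq.
rewrite addnC in yp' yq'; have e := cf_rep_of_uniq xp' yp'.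
apply: (cf_rep_of_fun xq'); move: yq'.
by rewrite !set_head_iter e.
Qed.

Lemma cf_actionE g p q : cf_moves g p q -> T g p = q.
Proof.
move=> pq; rewrite /cf_action; case: xgetP => [q' _ /cf_movesP pq'|/(_ q)[]].
  exact: cf_moves_fun pq' pq.
exact/cf_movesP.
Qed.

Lemma cf_rep_of_action g n x p : cf_rep_of n x p -> g + x 0%N \in F n ->
  cf_rep_of n (set_head (g + x 0%N) x) (T g p).
Proof.
move=> xp gxF; have [_ xC] := cf_rep_of_level xp.
have [q xq] : exists q, cf_rep_of n (set_head (g + x 0%N) x) q.
  by apply: cf_rep_of_level_ex; split.
by rewrite (_ : T g p = q)//; apply: cf_actionE; exists n, x.
Qed.

Lemma cyl_action g n f p : cyl S n f p -> g + f \in F n -> cyl S n (g + f) (T g p).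
Proof.
move=> /cylP[x xp <-] gxF; apply/cylP.
by exists (set_head (g + x 0%N) x) => //; exact: cf_rep_of_action.
Qed.

Hypothesis F_absorb : forall (g : G) n, (0 < n)%N -> exists2 m, (n < m)%N &
  (translate g (sumset (F n) (cfCsum S n m)) `<=` F m)%fset.

(** Once the translated head lies in some [F m], it stays in every later [F n], because further
    levels only add elements of the sets [C]. *)
Lemma cyl_absorb g p : exists N, forall n f, (N <= n)%N -> cyl S n f p ->
  g + f \in F n.
Proof.
have [n0 [f0 p0]] := cyl_ex p.
(* One refinement makes the level positive, as [F_absorb] demands. *)
have [c0 _ p1] := cyl_refine1 p0.
have [m n0m gF] := F_absorb g (ltn0Sn n0).
exists m => n f mn pn.
have [c cC pm] := cyl_refine (ltnW n0m) p1.
have [c' c'C pn'] := cyl_refine mn pm.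
rewrite (cyl_uniq pn pn') addrA; apply: (cfCsum_FP mn _ c'C).
apply: (fsubsetP gF); apply/imfsetP; exists (f0 + c0 + c) => //.
by apply/imfset2P; exists (f0 + c0); [exact: cyl_mem p1|exists c].
Qed.

Lemma cyl_absorb_seq (s : seq G) p : exists N, forall n f g, (N <= n)%N ->
  cyl S n f p -> g \in s -> g + f \in F n.
Proof.
elim: s => [|g s [N sN]]; first by exists 0%N.
have [M gM] := cyl_absorb g p; exists (maxn M N) => n f h.
rewrite geq_max => /andP[Mn Nn] pn; rewrite inE => /predU1P[->|hs].
  exact: gM.
exact: sN.
Qed.

Lemma cyl_large N p : exists n f, (N <= n)%N /\ cyl S n f p.
Proof.
have [m [f pm]] := cyl_ex p.
have [f' p'] := cyl_level_ge (leq_maxl m N) pm.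
by exists (maxn m N), f'; rewrite leq_maxr.
Qed.

Lemma cf_action0 p : T 0 p = p.
Proof.
apply: cf_actionE; have [n [x xp]] := cf_rep_of_ex p; exists n, x; split=> //.
by apply: (cf_rep_of_ext xp) => -[|k]; rewrite /= ?add0r.
Qed.

Lemma cf_actionD g h p : T (g + h) p = T g (T h p).
Proof.
have [N sN] := cyl_absorb_seq [:: h; g + h] p.
have [n [f [Nn pf]]] := cyl_large N p.
have hf : h + f \in F n by apply: sN Nn pf _; rewrite inE eqxx.
have ghf : g + h + f \in F n by apply: sN Nn pf _; rewrite !inE eqxx orbT.
have /cylP[x xp x0] := pf; subst f.
have yp := cf_rep_of_action xp hf.
have := @cf_rep_of_action g _ _ _ yp; rewrite /= addrA => /(_ ghf) zp.
apply: (cf_rep_of_fun (cf_rep_of_action xp ghf)).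
by apply: (cf_rep_of_ext zp) => -[].
Qed.

Lemma cf_actionNK g : cancel (T g) (T (- g)).
Proof. by move=> p; rewrite -cf_actionD addNr cf_action0. Qed.

Lemma cf_actionKN g : cancel (T (- g)) (T g).
Proof. by move=> p; rewrite -cf_actionD addrN cf_action0. Qed.

Lemma image_cf_action g (B : set (cf_space S)) : T g @` B = T (- g) @^-1` B.
Proof.
apply/seteqP; split=> [_ [p Bp <-]|p Bp] /=; first by rewrite cf_actionNK.
by exists (T (- g) p) => //; rewrite cf_actionKN.
Qed.

Lemma preimage_cyl g n f : f \in F n -> g + f \in F n ->
  T g @^-1` cyl S n (g + f) = cyl S n f.
Proof.
move=> fF gfF; apply/seteqP; split=> p /=; last by move=> /cyl_action; exact.
by move=> /(@cyl_action (- g)); rewrite cf_actionNK addKr; exact.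
Qed.

End Action.

(** * Cylinders and the Borel sigma-algebra *)

Section CylinderTopology.
Context {G : countZmodType} (S : cf_sequence G).
Notation F := (cfF S).
Notation Prod := (prod_topology (fun _ : nat => discrete_topology G)).
Implicit Types (x y : nat -> G) (p q : cf_space S) (n m : nat) (f g h c : G).

Lemma iter_cf_shiftS i x k : iter i cf_shift x k.+1 = x (i + k.+1)%N.
Proof. by elim: i k => [//|i ih] k; rewrite iterS /= ih addSnnS. Qed.

Lemma iter_cf_shift0 i x : iter i cf_shift x 0%N = \sum_(k < i.+1) x k.
Proof.
elim: i => [|i ih]; first by rewrite big_ord1.
by rewrite iterS /= ih iter_cf_shiftS addn1 [RHS]big_ord_recr.
Qed.

Lemma nbhs_agree N x :
  nbhs (x : Prod) [set y : Prod | forall k, (k < N)%N -> y k = x k].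
Proof.
elim: N => [|N ih]; first by apply: filterS filterT => y _ k; rewrite ltn0.
have xN : nbhs (x : Prod) [set y : Prod | y N = x N].
  exact: (@proj_continuous _ (fun _ : nat => discrete_topology G) N x _
            (@discrete_set1 (discrete_topology G) (x N))).
apply: filterS (filterI ih xN) => y [yx yN] k.
by rewrite ltnS leq_eqVlt => /predU1P[->|/yx].
Qed.

Lemma open_finite_coordinates N (O : set Prod) :
  (forall x y, (forall k, (k < N)%N -> y k = x k) -> O x -> O y) -> open O.
Proof.
move=> OP; rewrite openE => x Ox; apply: filterS (nbhs_agree N x) => y xy.
exact: OP Ox.
Qed.

(** The sets of sequences agreeing with [x] up to [N] generate a filter that converges to [x] in
    each coordinate, hence in the product, so [O] contains one of them. *)
Lemma open_agree_sub (O : set Prod) x : open O -> O x ->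
  exists N, forall y, (forall k, (k < N)%N -> y k = x k) -> O y.
Proof.
move=> oO Ox.
pose B N : set Prod := [set y | forall k, (k < N)%N -> y k = x k].
pose A := filter_from setT B.
have AF : Filter A.
  apply: filter_from_filter; first by exists 0%N.
  move=> i j _ _; exists (maxn i j) => // y xy.
  by split=> k kl; apply: xy; rewrite leq_max kl ?orbT.
have Ax : A --> (x : Prod).
  apply/cvg_sup => i; apply/cvg_image => //.
    by rewrite eqEsubset; split=> // a _; exists (fun=> a).
  move=> V /nbhs_singleton Vx; exists [set y : Prod | V (y i)].
    by exists i.+1 => // y /(_ i (ltnSn i)) /= ->.
  by apply/seteqP; split=> [_ [y /= Vy <-]//|a /= Va]; exists (fun=> a).
by have [N _ NO] := Ax O (open_nbhs_nbhs (conj oO Ox)); exists N.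
Qed.

Lemma open_cf_spaceP (U : set (cf_space S)) : open U <->
  forall m, exists2 O : set Prod, open O &
    forall x p, cf_rep_of m x p -> (O x <-> U p).
Proof.
split=> [oU m|UO].
  have := oU : open
    ((\pi_(quotient_topology {eq_quot cf_equiv_rel S}))%qT @^-1` U).
  move=> /sigT_openP /(_ m) [W oO OU].
  exists W => // x p [u [<- ->]].
  by have := congr1 (@^~ u) OU; rewrite /preimage/= => ->.
suff : open ((\pi_(quotient_topology {eq_quot cf_equiv_rel S}))%qT @^-1` U).
  exact.
apply/sigT_openP => m; have [W oO OU] := UO m; exists W => //.
apply/seteqP; split=> u /=.
  by move/(OU _ (cf_in u)); apply; exists u.
by move=> uU; apply/(OU _ (cf_in u)) => //; exists u.
Qed.

Lemma cyl_open n f : open (cyl S n f).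
Proof.
have [fF|fF] := boolP (f \in F n); last first.
  rewrite (_ : cyl S n f = set0); first exact: open0.
  by apply/seteqP; split=> // p /cyl_mem; rewrite (negbTE fF).
(* Seen from level [m <= n], the level-[n] head is a sum of finitely many coordinates; seen from
   [m > n], membership is a condition on coordinate 0 alone. *)
apply/open_cf_spaceP => m; have [mn|nm] := leqP m n.
  exists [set x : Prod | iter (n - m) cf_shift (x : nat -> G) 0%N = f].
    apply: (@open_finite_coordinates (n - m).+1) => x y xy /=.
    rewrite !iter_cf_shift0 => <-; apply: eq_bigr => k _; exact: xy.
  move=> x p /(cf_rep_of_iter (n - m)); rewrite subnKC// => xp.
  split=> /= [xf|/cylP[y yp <-]]; first by apply/cylP; eexists; first exact: xp.
  by rewrite (cf_rep_of_uniq xp yp).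
exists [set x : Prod | exists2 c, c \in cfCsum S n m & x 0%N = f + c].
  apply: (@open_finite_coordinates 1) => x y xy /= [c cC x0].
  by exists c => //; rewrite xy.
move=> x p xp; split=> [[c cC x0]|/(cyl_refine (ltnW nm))[c cC]].
  apply: (cyl_coarsen (ltnW nm) fF cC); apply/cylP.
  by exists x.
by move=> /cylP[y yp y0]; exists c => //=; rewrite (cf_rep_of_uniq xp yp).
Qed.

Lemma open_cyl_sub (U : set (cf_space S)) p : open U -> U p ->
  exists n f, cyl S n f p /\ cyl S n f `<=` U.
Proof.
move=> /open_cf_spaceP UO Up; have [m [x xp]] := cf_rep_of_ex p.
have [W oO OU] := UO m; have [N ON] := open_agree_sub oO (proj2 (OU _ _ xp) Up).
have xNp := cf_rep_of_iter N xp.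
exists (m + N)%N, (iter N cf_shift x 0%N); split.
  by apply/cylP; exists (iter N cf_shift x).
move=> q /cylP[w wq w0].
(* Splicing the initial segment of [x] to the tail of [w]: the [N]-fold shift adds up coordinates 0
   to [N], which gives the head of [w], so [y] represents [q] at level [m] and agrees with [x]
   there. *)
pose y k := if (k <= N)%N then x k else w (k - N)%N.
have yx k : (k <= N)%N -> y k = x k by rewrite /y => ->.
have [x0F xC] := cf_rep_of_level xp.
have ym : cf_level S m y.
  split=> [|k]; rewrite /y//; case: leqP => // Nk.
  have [_ /(_ (k - N)%N)] := cf_rep_of_level wq.
  by rewrite -subSn -1?ltnS// -addnA subnKC 1?ltnW.
have [q' yq'] := cf_rep_of_level_ex ym.
have e : iter N cf_shift y = w.
  apply/funext => -[|k]; last first.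
    by rewrite iter_cf_shiftS /y leqNgt -addSnnS ltn_addr//= addSnnS addKn.
  rewrite w0 !iter_cf_shift0; apply: eq_bigr => k _; apply: yx.
  by rewrite -ltnS.
have yq := cf_rep_of_iter N yq'; rewrite e in yq.
rewrite (cf_rep_of_fun wq yq); apply/(OU _ _ yq'); apply: ON => k kN.
by apply: yx; exact: ltnW.
Qed.

End CylinderTopology.

(** * Cylinders as a generating system stable under intersection *)

Section CylinderSystem.
Context {G : countZmodType} (S : cf_sequence G).
Implicit Types (p q : cf_space S) (n m : nat) (f g h c : G).

Lemma measurable_open_cf (U : set (cf_space S)) : open U -> measurable U.
Proof. by move=> oU; exact: sub_sigma_algebra. Qed.

Lemma measurable_cyl n f : measurable (cyl S n f).
Proof. by apply: measurable_open_cf; exact: cyl_open. Qed.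

Variable P : nat -> G -> Prop.

(** [P] singles out the cylinders on which a computation is possible, for instance those of high
    level or those whose translate is again a cylinder. The empty set is added because two cylinders
    may be disjoint. *)
Definition cyl_system : set_system (cf_space S) :=
  [set A | A = set0 \/ exists n f, P n f /\ A = cyl S n f].

Lemma cyl_system_setI_closed : setI_closed cyl_system.
Proof.
move=> A B [->|[n [f [Pf ->]]]]; first by rewrite set0I; left.
move=> [->|[m [g [Pg ->]]]]; first by rewrite setI0; left.
have [[p [pf pg]]|none] := pselect (exists p, cyl S n f p /\ cyl S m g p); last first.
  left; apply/seteqP; split=> // p [pf pg]; apply: none; by exists p.
right; have [nm|/ltnW mn] := leqP n m.
  by exists m, g; split=> //; apply/setIidPr; exact: cyl_sub pf pg.
by exists n, f; split=> //; apply/setIidPl; exact: cyl_sub pg pf.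
Qed.

Hypothesis P_cofinal : forall p n, exists m f, [/\ (n <= m)%N, P m f & cyl S m f p].

(** Admissible cylinders form a base of the topology, and there are only countably many of them
    because [G] is countable. *)
Lemma cyl_systemE : @measurable _ (cf_space S) = <<s cyl_system >>.
Proof.
apply/seteqP; split; last first.
  apply: smallest_sub; first exact: sigma_algebra_measurable.
  by move=> A [->|[n [f [_ ->]]]]; [exact: measurable0|exact: measurable_cyl].
apply: smallest_sub; first exact: smallest_sigma_algebra.
move=> U oU.
pose I := [set i : nat * G | P i.1 i.2 /\ cyl S i.1 i.2 `<=` U].
have -> : U = \bigcup_(i in I) cyl S i.1 i.2.
  apply/seteqP; split=> [p Up|p [i [_ iU]] /iU//].
  have [n [f [pf fU]]] := open_cyl_sub oU Up.
  have [m [g [nm Pg pg]]] := P_cofinal p n.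
  exists (m, g) => //; split=> //=; apply: subset_trans fU.
  exact: cyl_sub pf pg.
pose gT := g_sigma_algebraType cyl_system.
rewrite bigcup_mkcond.
apply: (@countable_bigcupT_measurable _ gT); first exact: countableP.
move=> i; case: ifPn => [/set_mem[Pi _]|_]; last exact: (@measurable0 _ gT).
by apply: sub_sigma_algebra; right; exists i.1, i.2.
Qed.

Lemma cf_measure_unique {R : realType}
    (m1 m2 : {measure set (cf_space S) -> \bar R}) :
  (forall n f, P n f -> m1 (cyl S n f) = m2 (cyl S n f)) ->
  (forall n f, P n f -> (m1 (cyl S n f) < +oo)%E) ->
  forall A, measurable A -> m1 A = m2 A.
Proof.
move=> m12 m1oo A mA.
(* An enumeration of the admissible cylinders, with the empty set for all other codes; it is the
   countable cover by sets of finite measure that uniqueness of measures asks for. *)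
pose g k : set (cf_space S) := if (choice.unpickle k : option (nat * G)) is Some i
  then (if `[< P i.1 i.2 >] then cyl S i.1 i.2 else set0) else set0.
have gS k : cyl_system (g k).
  rewrite /g; case: (choice.unpickle _ : option (nat * G)) => [i|]; last by left.
  by case: asboolP => Pi; [right; exists i.1, i.2|left].
apply: (measure_unique cyl_system g) => //.
- exact: cyl_systemE.
- exact: cyl_system_setI_closed.
- apply/seteqP; split=> // p _; have [m [f [_ Pf pf]]] := P_cofinal p 0.
  by exists (choice.pickle (m, f)) => //; rewrite /g choice.pickleK /= asboolT.
- by move=> B [->|[n [f [Pf ->]]]]; [rewrite !measure0|exact: m12].
- move=> k; case: (gS k) => [->|[n [f [Pf ->]]]]; last exact: m1oo.
  by rewrite measure0.
Qed.

End CylinderSystem.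

(** * Invariant measures *)

Section Multiplicity.
Context {d : measure_display} {X : measurableType d} {R : realType}
  {I : eqType}.
Variables (mu : {measure set X -> \bar R}) (s : seq I) (B : I -> set X).
Hypothesis mB : forall i, measurable (B i).
Local Open Scope ereal_scope.

(** Exchanging the finite sum with the integral of indicators; pointwise bounds on the number of
    visits thereby become bounds on return sums. *)
Lemma sum_measureI (A : set X) : measurable A ->
  \sum_(i <- s) mu (A `&` B i) =
  \int[mu]_(x in A) (count (fun i => x \in B i) s)%:R%:E.
Proof.
move=> mA; have mi i : measurable_fun A (EFin \o (\1_(B i) : X -> R)).
  by apply/measurable_EFinP; exact: measurable_funTS (measurable_indic _).
transitivity (\sum_(i <- s) \int[mu]_(x in A) (\1_(B i) x : R)%:E).
  by apply: eq_bigr => i _; rewrite integral_indic// setIC.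
rewrite -ge0_integral_sum//.
apply: eq_integral => x _; rewrite -sum1_count natr_sum -sumEFin.
rewrite [RHS]big_mkcond /=; apply: eq_bigr => i _.
by rewrite indicE; case: (x \in B i).
Qed.

Lemma measurable_count A : measurable A ->
  measurable_fun A (fun x => (count (fun i => x \in B i) s)%:R%:E : \bar R).
Proof.
move=> mA.
rewrite (_ : (fun x => _) = fun x => \sum_(i <- s) (\1_(B i) x : R)%:E); last first.
  apply/funext => x; rewrite -sum1_count natr_sum -sumEFin.
  rewrite big_mkcond /=; apply: eq_bigr => i _.
  by rewrite indicE; case: (x \in B i).
apply: emeasurable_sum => i.
by apply/measurable_EFinP; exact: measurable_funTS (measurable_indic _).
Qed.

Lemma sum_measureI_le (A : set X) N : measurable A ->
  (forall x, A x -> (count (fun i => x \in B i) s <= N)%N) ->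
  \sum_(i <- s) mu (A `&` B i) <= N%:R%:E * mu A.
Proof.
move=> mA AN; rewrite sum_measureI// -integral_cst//.
apply: ge0_le_integral => //; first exact: measurable_count.
by move=> x Ax; rewrite lee_fin ler_nat; exact: AN.
Qed.

Lemma sum_measureI_ge (A : set X) N : measurable A ->
  (forall x, A x -> (N <= count (fun i => x \in B i) s)%N) ->
  N%:R%:E * mu A <= \sum_(i <- s) mu (A `&` B i).
Proof.
move=> mA AN; rewrite sum_measureI// -integral_cst//.
apply: ge0_le_integral => //; first by move=> x _; rewrite lee_fin.
  exact: measurable_count.
by move=> x Ax; rewrite lee_fin ler_nat; exact: AN.
Qed.

End Multiplicity.

Section PushforwardMeasure.
Context {d d' : measure_display} {X : measurableType d} {Y : measurableType d'}
  {R : realType}.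
Variables (m : {measure set X -> \bar R}) (f : X -> Y).
Hypothesis mf : measurable_fun setT f.

Definition pushforward_measure : {measure set Y -> \bar R} :=
  measure_function_pushforward__canonical__measure_function_Measure m mf.

Lemma pushforward_measureE A : pushforward_measure A = m (f @^-1` A).
Proof. by []. Qed.

Lemma measurable_preimage A : measurable A -> measurable (f @^-1` A).
Proof. by move=> mA; rewrite -[X in measurable X]setTI; exact: mf. Qed.

End PushforwardMeasure.

(** * Invariant measures are determined by the mass of [[0]_0] *)

Section ActionMeasure.
Context {R : realType} {G : countZmodType} (S : cf_sequence G).
Notation F := (cfF S).
Notation C := (cfC S).
Notation T := (cf_action S).
Notation Y := (cyl S 0 0).
Implicit Types (p q : cf_space S) (n m l : nat) (f g h c : G).

Hypothesis F_absorb : forall (g : G) n, (0 < n)%N -> exists2 m, (n < m)%N &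
  (translate g (sumset (F n) (cfCsum S n m)) `<=` F m)%fset.

(** The pairs for which the preimage of the cylinder under [T g] is a cylinder of the same level.
    Each point has such cylinders at arbitrarily high levels, so measurability and invariance may be
    tested on them. *)
Let stays g n f := f \in F n /\ - g + f \in F n.

Lemma stays_cofinal g p n :
  exists m f, [/\ (n <= m)%N, stays g m f & cyl S m f p].
Proof.
have [N NF] := cyl_absorb F_absorb (- g) p.
have [m [f [nm pf]]] := cyl_large (maxn n N) p.
move: nm; rewrite geq_max => /andP[nm Nm]; exists m, f; split=> //.
by split; [exact: cyl_mem pf|exact: NF pf].
Qed.

Lemma preimage_cyl_stays g n f : stays g n f ->
  T g @^-1` cyl S n f = cyl S n (- g + f).
Proof.
move=> [fF gfF]; have := @preimage_cyl _ S F_absorb g n (- g + f) gfF.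
by rewrite addrA addrN add0r; exact.
Qed.

Lemma measurable_cf_action g : measurable_fun setT (T g).
Proof.
apply: (@measurability _ _ _ _ setT (T g) (@cyl_system _ S (stays g))).
  apply: cyl_systemE; exact: stays_cofinal.
move=> _ [_ [->|[n [f [fP ->]]]] <-]; rewrite setTI.
  by rewrite preimage_set0; exact: measurable0.
by rewrite preimage_cyl_stays//; exact: measurable_cyl.
Qed.

Lemma measurable_preimage_action g A : measurable A -> measurable (T g @^-1` A).
Proof. exact: (measurable_preimage (measurable_cf_action g)). Qed.

Lemma cyl_bigcup (A : set (cf_space S)) l m f : (l <= m)%N -> f \in F l ->
  A `&` cyl S l f =
  \bigcup_(c in [set` cfCsum S l m]) (A `&` cyl S m (f + c)).
Proof.
move=> lm fF; apply/seteqP; split=> [p [Ap /(cyl_refine lm)[c cC pc]]|p].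
  by exists c.
by move=> [c cC [Ap pc]]; split=> //; exact: (cyl_coarsen lm fF cC).
Qed.

Lemma measure_cyl_refine (nu : {measure set (cf_space S) -> \bar R})
    (A : set (cf_space S)) l m f : measurable A -> (l <= m)%N -> f \in F l ->
  nu (A `&` cyl S l f) = (\sum_(c <- cfCsum S l m) nu (A `&` cyl S m (f + c)%R))%E.
Proof.
move=> mA lm fF; rewrite (cyl_bigcup A lm fF) measure_fin_bigcup.
- by rewrite [RHS]fsbig_seq.
- exact: finite_seq.
- move=> c c' _ _ [p [[_ pc] [_ pc']]].
  exact/(addrI f)/(cyl_uniq pc pc').
- by move=> c _; apply: measurableI => //; exact: measurable_cyl.
Qed.

Section InvariantMeasure.
Variable nu : {measure set (cf_space S) -> \bar R}.
Hypothesis nuT : forall g A, measurable A -> nu (T g @^-1` A) = nu A.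
Hypothesis nuY : (nu Y < +oo)%E.

(** Nonempty cylinders of one level are translates of each other, and [[0]_0] is the disjoint union
    of those with head in [cfCsum S 0 n]. *)
Lemma invariant_measure_cyl n f : f \in F n ->
  nu (cyl S n f) = ((fine (nu Y)) / #|` cfCsum S 0 n|%:R)%:E.
Proof.
move=> fF; have F0 : 0 \in F 0 by rewrite cfF0 inE.
have cyl_eq f' : f' \in F n -> nu (cyl S n f') = nu (cyl S n f).
  move=> f'F; rewrite -(nuT (f - f') (measurable_cyl n f)).
  have := @preimage_cyl _ S F_absorb (f - f') n f'.
  by rewrite subrK => ->.
have e : nu Y = (\sum_(c <- cfCsum S 0 n) nu (cyl S n f))%E.
  rewrite -[in LHS](setTI Y) (@measure_cyl_refine nu setT 0 n 0)//.
  rewrite !big_seq; apply: eq_bigr => c cC; rewrite setTI cyl_eq//.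
  exact: cfCsum_FP cC.
have [p pY] := cyl_nonempty F0.
have [c cC pc] := cyl_refine (leq0n n) pY.
have A0 : (0 < #|` cfCsum S 0 n|)%N.
  by rewrite cardfs_gt0; apply/fset0Pn; exists c.
(* Finiteness holds for a cylinder inside [[0]_0] and is carried to [f] by invariance. *)
have nuf : (nu (cyl S n f) < +oo)%E.
  rewrite -(cyl_eq _ (cyl_mem pc)); apply: le_lt_trans nuY.
  apply: le_measure; rewrite ?inE; try exact: measurable_cyl.
  exact: cyl_sub pY pc.
have fin : nu (cyl S n f) \is a fin_num by rewrite ge0_fin_numE.
rewrite e -(fineK fin) sumEFin /= big_const_seq count_predT.
rewrite iter_addr_0 -(mulr_natr (fine _)) mulfK// pnatr_eq0 -lt0n.
exact: A0.
Qed.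

End InvariantMeasure.

Lemma invariant_measure_unique (nu1 nu2 : {measure set (cf_space S) -> \bar R}) :
  (forall g A, measurable A -> nu1 (T g @^-1` A) = nu1 A) ->
  (forall g A, measurable A -> nu2 (T g @^-1` A) = nu2 A) ->
  (nu1 Y < +oo)%E -> nu1 Y = nu2 Y ->
  forall A, measurable A -> nu1 A = nu2 A.
Proof.
move=> nu1T nu2T Y1 Y12; have Y2 : (nu2 Y < +oo)%E by rewrite -Y12.
apply: (@cf_measure_unique _ _ (fun n f => f \in F n)).
- move=> p n; have [m [f [nm pf]]] := cyl_large n p.
  by exists m, f; split=> //; exact: cyl_mem pf.
- move=> n f fF; rewrite (invariant_measure_cyl nu1T Y1 fF).
  by rewrite (invariant_measure_cyl nu2T Y2 fF) Y12.
- by move=> n f fF; rewrite (invariant_measure_cyl nu1T Y1 fF) ltry.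
Qed.

Variable mu : {measure set (cf_space S) -> \bar R}.
Hypothesis mu_cyl : forall n (A : {fset G}), (A `<=` F n)%fset ->
  mu (cylinder S n A) = (#|` A|%:R / \prod_(1 <= k < n.+1) #|` C k|%:R)%:E.

Lemma cf_measure_cyl n f : f \in F n ->
  mu (cyl S n f) = ((\prod_(1 <= k < n.+1) #|` C k|%:R)^-1)%:E.
Proof. by move=> fF; rewrite mu_cyl ?fsub1set// cardfs1 div1r. Qed.

(** On [stays] cylinders the pushforward agrees with [mu], since the measure of a nonempty cylinder
    depends on its level only. *)
Lemma cf_measure_invariant g A : measurable A -> mu (T g @^-1` A) = mu A.
Proof.
apply: (@cf_measure_unique _ _ (stays g) _ _
  (pushforward_measure mu (measurable_cf_action g)) mu).
- exact: stays_cofinal.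
- move=> n f fP; rewrite pushforward_measureE preimage_cyl_stays//.
  by case: fP => fF gfF; rewrite !cf_measure_cyl.
- move=> n f fP; rewrite pushforward_measureE preimage_cyl_stays//.
  by case: fP => fF gfF; rewrite cf_measure_cyl// ltry.
Qed.

End ActionMeasure.

(** * Counting visits to [0]_0 *)

Section Visits.
Context {G : countZmodType} (S : cf_sequence G).
Notation F := (cfF S).
Notation C := (cfC S).
Notation T := (cf_action S).
Notation Y := (cyl S 0 0).
Notation E n := (diffset (F n) (F n)).
Notation A n := (cfCsum S 0 n).
Implicit Types (p q : cf_space S) (n m l : nat) (f g h c a : G).

Lemma diffsetP (B D : {fset G}) g :
  reflect (exists b d, [/\ b \in B, d \in D & g = b - d]) (g \in diffset B D).
Proof.
apply: (iffP (imfset2P _ _ _ _ _)).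
  by move=> [b /= bB [c /= cD ->]]; exists b, c.
by move=> [b [c [bB cD ->]]]; exists b => //; exists c.
Qed.

Lemma diffset_opp (B : {fset G}) g :
  (- g \in diffset B B) = (g \in diffset B B).
Proof.
suff opp h : h \in diffset B B -> - h \in diffset B B.
  by apply/idP/idP => /opp //; rewrite opprK.
by move=> /diffsetP[b [c [bB cB ->]]]; apply/diffsetP; exists c, b; rewrite opprB.
Qed.

Lemma perm_diffset_opp (B : {fset G}) :
  perm_eq [seq - g | g <- diffset B B] (diffset B B).
Proof.
apply: uniq_perm; rewrite ?(map_inj_uniq oppr_inj) ?fset_uniq// => g.
apply/mapP/idP => [[h hB ->]|gB]; first by rewrite diffset_opp.
by exists (- g); rewrite ?opprK// diffset_opp.
Qed.

Lemma cfF0_0 : 0 \in F 0. Proof. by rewrite cfF0 inE. Qed.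

Lemma cfCsum0_F n a : a \in A n -> a \in F n.
Proof. by move=> aA; rewrite -(add0r a); apply: (cfCsum_FP _ cfF0_0 aA). Qed.

Lemma cfCsum0_sub n a : a \in A n -> cyl S n a `<=` Y.
Proof.
move=> aA; rewrite -{1}(add0r a) => p.
exact: (cyl_coarsen (leq0n n) cfF0_0 aA).
Qed.

Lemma cyl_cfCsum0 n f p : Y p -> cyl S n f p -> f \in A n.
Proof.
move=> Yp pf; have [c cA pc] := cyl_refine (leq0n n) Yp.
by rewrite (cyl_uniq pf pc) add0r.
Qed.

Lemma diffsetS n : (E n `<=` E n.+1)%fset.
Proof.
apply/fsubsetP => _ /diffsetP[f [f' [fF f'F ->]]].
case: (fset_0Vmem (C n.+1)) => [C0|[c cC]].
  by have := cfC_gt1 S n; rewrite C0 cardfs0.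
apply/diffsetP; exists (f + c), (f' + c).
split; last by rewrite opprD addrACA subrr addr0.
  by apply: (fsubsetP (cfFC_sub S n)); apply/imfset2P; exists f => //; exists c.
by apply: (fsubsetP (cfFC_sub S n)); apply/imfset2P; exists f' => //; exists c.
Qed.

Hypothesis F_absorb : forall (g : G) n, (0 < n)%N -> exists2 m, (n < m)%N &
  (translate g (sumset (F n) (cfCsum S n m)) `<=` F m)%fset.

Definition visits n p := count (fun g => p \in T g @^-1` Y) (E n).

Lemma visits_opp n p :
  count (fun g => p \in T (- g) @^-1` Y) (E n) = visits n p.
Proof.
have /seq.permP/(_ (fun g => p \in T g @^-1` Y)) := perm_diffset_opp (F n).
by rewrite count_map.
Qed.

(** For each [a] in [A n] the element [a - f] lies in [F n - F n] and moves [p] to the head [a],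
    hence into [[0]_0]. *)
Lemma visits_ge n f p : cyl S n f p -> (#|` A n| <= visits n p)%N.
Proof.
move=> pf; rewrite /visits -size_filter.
rewrite -(size_map (fun a => a - f) (A n)); apply: uniq_leq_size.
  by rewrite (map_inj_uniq (addIr (- f))) fset_uniq.
move=> _ /mapP[a aA ->]; have aF := cfCsum0_F aA.
rewrite mem_filter; apply/andP; split.
  apply/mem_set; apply: (cfCsum0_sub aA).
  by rewrite -{1}(subrK f a); apply: cyl_action => //; rewrite subrK.
by apply/diffsetP; exists a, f; split=> //; exact: cyl_mem pf.
Qed.

Variable K : nat.
Hypothesis F_cover : forall n, exists d : 'I_K -> G,
  forall g, g \in E n -> exists j, g \in translate (d j) (F n).

(* If [g] is in [F n - F n] and [T g p] is in [cyl n a], then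
   [g = d j + d j' + b + a] with [b] in [F n].  If [g' = d j + d j' + b' + a] is
   another such element, then [T (b' + g - a) p = T (b + g' - a) p] lies in both
   [cyl n b'] and [cyl n b]; so [(a, j, j')] determines [g]. *)
Lemma visits_le n p : (visits n p <= K * K * #|` A n|)%N.
Proof.
have [d dE] := F_cover n.
pose good g (t : G * ('I_K * 'I_K)) := [/\ t.1 \in A n, cyl S n t.1 (T g p) &
  exists2 b, b \in F n & g = d t.2.1 + d t.2.2 + b + t.1].
have split_diff u : u \in E n -> exists j x, x \in F n /\ u = d j + x.
  by move=> /dE[j /imfsetP[x xF ->]]; exists j, x.
have goodE g : g \in E n -> Y (T g p) -> exists t, good g t.
  move=> gE Yg; have [a aA ag] := cyl_refine (leq0n n) Yg.
  rewrite add0r in ag; have [j [x [xF gx]]] := split_diff _ gE.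
  (* Both [x] and [a] lie in [F n], so the covering applies a second time; this is the source of the
     square of [K]. *)
  have [j' [b [qF xq]]] : exists j' b, b \in F n /\ x - a = d j' + b.
    apply: split_diff; apply/diffsetP; exists x, a.
    by split=> //; exact: cfCsum0_F.
  exists (a, (j, j')); split=> //=; exists b => //.
  by rewrite gx -(subrK a x) xq !addrA.
have good_inj g g' t : good g t -> good g' t -> g = g'.
  move=> [tA gt [b qF gE]] [_ g't [b' b'F g'E]].
  suff qq' : b = b' by rewrite gE g'E qq'.
  have gq := @cyl_action _ S (b' - t.1) _ _ _ gt.
  have g'b := @cyl_action _ S (b - t.1) _ _ _ g't.
  rewrite -!(cf_actionD F_absorb) !subrK in gq g'b.
  have e : b' - t.1 + g = b - t.1 + g'.
    by rewrite gE g'E !(addrACA _ (- t.1)) addNr !addr0 addrC [RHS]addrC addrAC.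
  by rewrite e in gq; apply/esym; apply: cyl_uniq (gq b'F) (g'b qF).
rewrite /visits -size_filter.
set s := [seq g <- E n | p \in T g @^-1` Y].
have sP g : g \in s -> g \in E n /\ Y (T g p).
  by rewrite mem_filter => /andP[/set_mem].
have : uniq s by rewrite filter_uniq ?fset_uniq.
(* A member of [s] supplies the default triple [t0] used to choose [t] as a total function. *)
case: s sP => [//|g0 s'].
move: (g0 :: s') (mem_head g0 s') => {s'}s g0s sP su.
have [t0 _] : exists t, good g0 t by have [? ?] := sP _ g0s; exact: goodE.
have /choice[t tP] : forall g, exists t, g \in s -> good g t.
  move=> g; have [/sP[gE Yg]|gs] := boolP (g \in s); last by exists t0.
  by have [t gt] := goodE _ gE Yg; exists t.
have -> : (K * K * #|` A n| =
    size [seq (a, j) | a <- A n : seq G, j <- enum {: 'I_K * 'I_K}])%N.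
  by rewrite size_allpairs -cardE card_prod card_ord mulnC.
rewrite -(size_map t); apply: uniq_leq_size.
  rewrite map_inj_in_uniq// => g g' gs g's e.
  by apply: good_inj (tP _ gs) _; rewrite e; exact: tP.
move=> _ /mapP[g gs ->]; have [tA _ _] := tP _ gs.
by apply/allpairsP; exists (t g); split=> //; [rewrite mem_enum|case: (t g)].
Qed.

End Visits.

(** * Return sums *)

Section ReturnSums.
Context {R : realType} {G : countZmodType} (S : cf_sequence G).
Notation F := (cfF S).
Notation C := (cfC S).
Notation T := (cf_action S).
Notation Y := (cyl S 0 0).
Notation E n := (diffset (F n) (F n)).
Notation alpha n := #|` cfCsum S 0 n|.
Implicit Types (p q : cf_space S) (n m l : nat) (f g h c a : G)
  (A B D : set (cf_space S)).

Hypothesis F_absorb : forall (g : G) n, (0 < n)%N -> exists2 m, (n < m)%N &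
  (translate g (sumset (F n) (cfCsum S n m)) `<=` F m)%fset.
Variable mu : {measure set (cf_space S) -> \bar R}.
Hypothesis mu_cyl : forall n (A : {fset G}), (A `<=` F n)%fset ->
  mu (cylinder S n A) = (#|` A|%:R / \prod_(1 <= k < n.+1) #|` C k|%:R)%:E.
Hypothesis muY : mu Y = 1%E.
Variable K : nat.
Hypothesis F_cover : forall n, exists d : 'I_K -> G,
  forall g, g \in E n -> exists j, g \in translate (d j) (F n).

Notation muT := (cf_measure_invariant F_absorb mu_cyl).
Notation mT := (measurable_preimage_action F_absorb).
Notation imT := (image_cf_action F_absorb).

Lemma measure_cylE n f : f \in F n -> mu (cyl S n f) = ((alpha n)%:R^-1)%:E.
Proof.
move=> fF; rewrite (@invariant_measure_cyl _ _ _ F_absorb mu _ _ n f fF).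
- by rewrite muY /= div1r.
- by move=> g A mA; exact: muT.
- by rewrite muY ltry.
Qed.

(** The two formulas for the measure of a level-[n] cylinder identify [alpha n] with the product of
    the cardinalities of the [C k], and each factor is at least 2. *)
Lemma card_cfCsum0_gt n : (n < alpha n)%N.
Proof.
have F0 := cfF0_0 S.
have [p pY] := cyl_nonempty F0; have [f pf] := cyl_level_ge (leq0n n) pY.
have : (\prod_(1 <= k < n.+1) #|` C k|%:R)^-1 = (alpha n)%:R^-1 :> R.
  have fF := cyl_mem pf; have := measure_cylE fF.
  by rewrite (cf_measure_cyl mu_cyl fF) => -[].
move=> /invr_inj; rewrite -natr_prod => /eqP; rewrite eqr_nat => /eqP <-.
elim: n {f pf} => [|n ih]; first by rewrite big_nil.
rewrite big_nat_recr//=; apply: leq_trans (leq_mul ih (cfC_gt1 S n)).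
by rewrite ltn_Pmulr.
Qed.

Lemma card_cfCsum0_gt0 n : 0 < (alpha n)%:R :> R.
Proof. by rewrite ltr0n; apply: leq_ltn_trans (card_cfCsum0_gt n). Qed.

Notation sumE n A B := (\sum_(g <- E n) mu (A `&` T g @` B))%E.
Notation rs n A B := (return_sum mu T (E n) A B).

Lemma measurable_image_action g A : measurable A -> measurable (T g @` A).
Proof. by move=> mA; rewrite imT; exact: mT. Qed.

Lemma measure_translate g A B : measurable A -> measurable B ->
  mu (A `&` T g @` B) = mu (B `&` T (- g) @` A).
Proof.
move=> mA mB; rewrite -(muT g); last first.
  by apply: measurableI => //; exact: measurable_image_action.
rewrite preimage_setI setIC !imT opprK; congr (mu (_ `&` _)).
by apply/seteqP; split=> p /=; rewrite cf_actionNK.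
Qed.

Lemma return_sumE n A B : measurable A -> measurable B -> (mu A < +oo)%E ->
  (rs n A B)%:E = sumE n A B.
Proof.
move=> mA mB Aoo; rewrite /return_sum -sumEFin; apply: eq_bigr => g _.
have mAB : measurable (A `&` T g @` B).
  by apply: measurableI => //; exact: measurable_image_action.
rewrite fineK// ge0_fin_numE//; apply: le_lt_trans Aoo.
by apply: le_measure; rewrite ?inE//; exact: subIsetl.
Qed.

Lemma sum_return_le n A : measurable A ->
  (sumE n A Y <= (K * K * alpha n)%:R%:E * mu A)%E.
Proof.
move=> mA; under eq_bigr do rewrite imT.
apply: sum_measureI_le => //.
  by move=> g; apply: mT; exact: measurable_cyl.
by move=> p _; rewrite (visits_opp n p); exact: visits_le.
Qed.

(** The lower bound on visits needs a level-[n] head, whence the intersection with the image of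
    [X_n]. *)
Lemma sum_return_ge n A : measurable A ->
  ((alpha n)%:R%:E * mu (A `&` \bigcup_(f in [set` F n]) cyl S n f) <=
    sumE n A Y)%E.
Proof.
move=> mA; set X := \bigcup_(f in _) _.
have mX : measurable X.
  by apply: fin_bigcup_measurable => // f _; exact: measurable_cyl.
have mg g : measurable (T (- g) @^-1` Y) by apply: mT; exact: measurable_cyl.
have : ((alpha n)%:R%:E * mu (A `&` X) <=
    \sum_(g <- E n) mu (A `&` X `&` T (- g)%R @^-1` Y))%E.
  apply: sum_measureI_ge => //; first exact: measurableI.
  by move=> p [_ [f _ pf]]; rewrite (visits_opp n p); exact: visits_ge pf.
move=> /le_trans; apply; apply: lee_sum => g _; rewrite imT.
apply: le_measure; rewrite ?inE; do ?[exact: measurableI|exact: mg].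
- by apply: measurableI => //; exact: measurableI.
- by apply: setSI; exact: subIsetl.
Qed.

Lemma return_sum_ge0 n A B : 0 <= rs n A B.
Proof. by rewrite /return_sum sumr_ge0. Qed.

Lemma measure_sub_ltry A : measurable A -> A `<=` Y -> (mu A < +oo)%E.
Proof.
move=> mA AY; apply: (@le_lt_trans _ _ (mu Y)); last by rewrite muY ltry.
by apply: le_measure; rewrite ?inE//; exact: measurable_cyl.
Qed.

Lemma measure_sub_fin A : measurable A -> A `<=` Y -> mu A \is a fin_num.
Proof. by move=> mA AY; rewrite ge0_fin_numE//; exact: measure_sub_ltry. Qed.

Lemma return_sumC n A B : measurable A -> measurable B ->
  rs n A B = rs n B A.
Proof.
move=> mA mB; rewrite /return_sum -(perm_big _ (perm_diffset_opp (F n))).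
rewrite big_map; apply: eq_bigr => g _.
by rewrite measure_translate// opprK.
Qed.

Lemma return_sum_le n A B : measurable A -> measurable B -> A `<=` Y ->
  B `<=` Y -> rs n A B <= (K * K * alpha n)%:R * fine (mu A).
Proof.
move=> mA mB AY BY; rewrite -lee_fin return_sumE//; last exact: measure_sub_ltry.
rewrite EFinM fineK; last exact: measure_sub_fin.
apply: le_trans (sum_return_le n mA); apply: lee_sum => g _.
have mg D : measurable D -> measurable (A `&` T g @` D).
  by move=> mD; apply: measurableI => //; exact: measurable_image_action.
apply: le_measure; rewrite ?inE; try exact: mg.
  by apply: mg; exact: measurable_cyl.
by apply: setIS; exact: image_subset.
Qed.

Lemma return_sum_YY n : (alpha n)%:R <= rs n Y Y.
Proof.
have mY := measurable_cyl (S := S) 0 0.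
rewrite -lee_fin return_sumE ?muY ?ltry//.
apply: le_trans (sum_return_ge n mY).
suff -> : Y `&` \bigcup_(f in [set` F n]) cyl S n f = Y by rewrite muY mule1.
apply/setIidPl => p pY; have [f pf] := cyl_level_ge (leq0n n) pY.
by exists f => //; exact: cyl_mem pf.
Qed.

Lemma return_sum_YY_gt0 n : 0 < rs n Y Y.
Proof. exact: lt_le_trans (card_cfCsum0_gt0 n) (return_sum_YY n). Qed.

Lemma return_sumD n A D B : measurable A -> measurable D -> measurable B ->
  D `<=` A -> A `<=` Y -> rs n (A `\` D) B = rs n A B - rs n D B.
Proof.
move=> mA mD mB DA AY; rewrite /return_sum -sumrB; apply: eq_bigr => g _.
have mg := measurable_image_action g mB.
have fin Z : Z `<=` A -> measurable Z -> mu (Z `&` T g @` B) \is a fin_num.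
  move=> ZA mZ; apply: measure_sub_fin; first exact: measurableI.
  by apply: subset_trans AY; apply: subset_trans ZA; exact: subIsetl.
have -> : mu (A `&` T g @` B) =
    (mu ((A `\` D) `&` T g @` B) + mu (D `&` T g @` B))%E.
  rewrite (measureDI mu (measurableI _ _ mA mg) mD) setIDAC setIDA.
  congr (_ + mu _)%E.
  by rewrite setIAC (setIidr DA).
rewrite fineD ?addrK//; apply: fin => //.
by apply: measurableD.
Qed.

(** * The limit law for Borel sets *)

Definition return_law A B :=
  return_ratio mu A B n @[n --> \oo] --> fine (mu A) * fine (mu B).

Lemma return_ratioE n A B : return_ratio mu A B n = rs n A B / rs n Y Y.
Proof. by []. Qed.

Lemma return_ratio_ge0 n A B : 0 <= return_ratio mu A B n.
Proof. by rewrite return_ratioE divr_ge0// return_sum_ge0. Qed.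

(** The factor [alpha n] of the numerator cancels against the lower bound for the denominator. The
    resulting uniformity in [n] is what lets the law pass to limits of sets. *)
Lemma return_ratio_le n A B : measurable A -> measurable B -> A `<=` Y ->
  B `<=` Y -> return_ratio mu A B n <= (K * K)%:R * fine (mu A).
Proof.
move=> mA mB AY BY; rewrite return_ratioE ler_pdivrMr ?return_sum_YY_gt0//.
apply: le_trans (return_sum_le n mA mB AY BY) _.
by rewrite natrM mulrAC ler_wpM2l ?return_sum_YY// mulr_ge0.
Qed.

Lemma return_lawC A B : measurable A -> measurable B ->
  return_law A B -> return_law B A.
Proof.
move=> mA mB; rewrite /return_law mulrC.
by under eq_fun do rewrite return_ratioE (return_sumC _ mA mB).
Qed.

Lemma fine_measureD A D : measurable A -> measurable D -> D `<=` A ->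
  A `<=` Y -> fine (mu (A `\` D)) = fine (mu A) - fine (mu D).
Proof.
move=> mA mD DA AY; rewrite measureD ?(setIidr DA)//; last exact: measure_sub_ltry.
by rewrite fineB// ?measure_sub_fin//; exact: subset_trans AY.
Qed.

Lemma return_ratioD n A D B : measurable A -> measurable D -> measurable B ->
  D `<=` A -> A `<=` Y ->
  return_ratio mu (A `\` D) B n = return_ratio mu A B n - return_ratio mu D B n.
Proof.
by move=> mA mD mB DA AY; rewrite !return_ratioE return_sumD// mulrBl.
Qed.

Lemma return_lawD A D B : measurable A -> measurable D -> measurable B ->
  D `<=` A -> A `<=` Y -> return_law A B -> return_law D B ->
  return_law (A `\` D) B.
Proof.
move=> mA mD mB DA AY lA lD; rewrite /return_law fine_measureD// mulrBl.
under eq_fun do rewrite return_ratioD//.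
exact: cvgB.
Qed.

Lemma return_lawU A D B : measurable A -> measurable D -> measurable B ->
  A `&` D = set0 -> A `<=` Y -> D `<=` Y -> return_law A B -> return_law D B ->
  return_law (A `|` D) B.
Proof.
move=> mA mD mB AD0 AY DY lA lD.
have mU : measurable (A `|` D) by exact: measurableU.
have UY : A `|` D `<=` Y by rewrite subUset.
have DE : (A `|` D) `\` A = D.
  by rewrite setDUl setDv set0U; apply/setDidl; rewrite setIC.
have AU : A `<=` A `|` D by exact: subsetUl.
have fU : fine (mu (A `|` D)) = fine (mu A) + fine (mu D).
  have := fine_measureD mU mA AU UY; rewrite DE => ->.
  by rewrite addrC subrK.
have rU n : return_ratio mu (A `|` D) B n =
    return_ratio mu A B n + return_ratio mu D B n.
  have := return_ratioD n mU mA mB AU UY; rewrite DE => ->.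
  by rewrite addrC subrK.
rewrite /return_law fU mulrDl; under eq_fun do rewrite rU.
exact: cvgD.
Qed.

Lemma return_law0 B : return_law set0 B.
Proof.
rewrite /return_law measure0 mul0r.
under eq_fun => n.
  rewrite return_ratioE /return_sum big1 ?mul0r; first by over.
  by move=> g _; rewrite set0I measure0.
exact: cvg_cst.
Qed.

(** Replacing [A] by [D] changes every ratio by at most [K * K] times the missing mass, uniformly in
    [n], so approximation from inside is enough. *)
Lemma return_law_approx A B : measurable A -> measurable B -> A `<=` Y ->
  B `<=` Y ->
  (forall e, 0 < e -> exists D, [/\ measurable D, D `<=` A, return_law D B &
     fine (mu A) - fine (mu D) <= e]) -> return_law A B.
Proof.
move=> mA mB AY BY approx; apply/cvgrPdist_le => e e0.
(* The first summand controls the error in the ratio, the second the error in the limit, where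
   [fine (mu B) <= 1]; the sum is also positive, so it can be divided by. *)
pose k : R := (K * K)%:R + 1.
have k0 : 0 < k by rewrite ltr_wpDl.
have [D [mD DA /cvgrPdist_le/(_ _ (divr_gt0 e0 (ltr0n _ 2))) lD AD]] :=
  approx (e / 2 / k) (divr_gt0 (divr_gt0 e0 (ltr0n _ 2)) k0).
have B1 : fine (mu B) <= 1.
  rewrite -[leRHS]/(fine (1%:E : \bar R)) -muY.
  apply: fine_le; rewrite ?measure_sub_fin//; first exact: measurable_cyl.
  by apply: le_measure; rewrite ?inE//; exact: measurable_cyl.
have AD0 : 0 <= fine (mu A) - fine (mu D).
  by rewrite -fine_measureD// fine_ge0.
near=> n.
have lDn : `|fine (mu D) * fine (mu B) - return_ratio mu D B n| <= e / 2.
  by near: n; exact: lD.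
have r0 := return_ratio_ge0 n (A `\` D) B.
have r1 : return_ratio mu (A `\` D) B n <=
    (K * K)%:R * (fine (mu A) - fine (mu D)).
  rewrite -fine_measureD//; apply: return_ratio_le => //.
    exact: measurableD.
  by apply: subset_trans AY; exact: subDsetl.
rewrite return_ratioD// in r0 r1.
have b0 : 0 <= (fine (mu A) - fine (mu D)) * fine (mu B).
  by rewrite mulr_ge0// fine_ge0.
have b1 : (fine (mu A) - fine (mu D)) * fine (mu B) <=
    fine (mu A) - fine (mu D) by rewrite ler_piMr.
have kAD : k * (fine (mu A) - fine (mu D)) <= e / 2.
  by rewrite mulrC -ler_pdivlMr.
rewrite /k in kAD.
move: lDn; rewrite !ler_norml => /andP[]; lra.
Unshelve. all: by end_near.
Qed.

(** The sets [A] for which [A] intersected with [Y] obeys the law form a Dynkin class: complements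
    are differences from [Y], and countable disjoint unions are approximated by finite ones.
    Cylinders of level at least [l] already generate. *)
Lemma return_law_extend B l : measurable B -> B `<=` Y -> return_law Y B ->
  (forall m f, (l <= m)%N -> cyl S m f `<=` Y -> return_law (cyl S m f) B) ->
  forall A, measurable A -> A `<=` Y -> return_law A B.
Proof.
move=> mB BY lY lcyl A mA AY; rewrite -(setIidl AY).
have mY := measurable_cyl (S := S) 0 0.
pose P m (f : G) := (l <= m)%N.
have Pcof p n : exists m f, [/\ (n <= m)%N, P m f & cyl S m f p].
  have [m [f [nm pf]]] := cyl_large (maxn n l) p.
  by move: nm; rewrite geq_max => /andP[nm lm]; exists m, f.
apply: (@dynkin_induction _ _ (@cyl_system _ S P)
  (fun A => return_law (A `&` Y) B)) => //.
- exact: cyl_systemE.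
- exact: cyl_system_setI_closed.
- by rewrite setTI.
- move=> _ [->|[m [f [lm ->]]]]; first by rewrite set0I; exact: return_law0.
  have [[p [pf pY]]|none] := pselect (exists p, cyl S m f p /\ Y p).
    have fY := cyl_sub (leq0n m) pY pf.
    by rewrite (setIidl fY); exact: lcyl.
  rewrite (_ : _ `&` _ = set0); first exact: return_law0.
  by apply/seteqP; split=> // p [pf pY]; apply: none; exists p.
- move=> D mD lD; rewrite (_ : ~` D `&` Y = Y `\` (D `&` Y)).
    by apply: return_lawD => //; exact: measurableI.
  by rewrite setDIr setDv setU0 setDE setIC.
- move=> D mD tD lD.
  have mDY n : measurable (D n `&` Y) by exact: measurableI.
  pose Z n := \big[setU/set0]_(k < n) (D k `&` Y).
  have ZE n : Z n = \bigcup_(k in `I_n) (D k `&` Y).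
    by rewrite (bigcup_mkord n (fun k => D k `&` Y)).
  have mZ n : measurable (Z n) by exact: bigsetU_measurable.
  have ZY n : Z n `<=` Y.
    by rewrite ZE; apply: bigcup_sub => k _; exact: subIsetr.
  have lZ n : return_law (Z n) B.
    elim: n => [|n ih]; first by rewrite /Z big_ord0; exact: return_law0.
    rewrite /Z big_ord_recr.
    apply: (return_lawU (mZ n) (mDY n) mB _ (ZY n) (@subIsetr _ _ _) ih (lD n)).
    rewrite ZE; apply/seteqP; split=> // p.
    move=> [[k /= kn [Dk _]] [Dn _]].
    by have := tD k n I I (ex_intro _ p (conj Dk Dn)) => kn'; rewrite kn' ltnn in kn.
  have UE : (\bigcup_k D k) `&` Y = \bigcup_n Z n.
    apply/seteqP; split=> p.
      move=> [[k _ Dk] pY]; exists k.+1 => //; rewrite ZE.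
      by exists k => //=.
    by move=> [n _]; rewrite ZE => -[k _ [Dk pY]]; split=> //; exists k.
  have mU : measurable (\bigcup_n Z n) by exact: bigcupT_measurable.
  have UY : \bigcup_n Z n `<=` Y by exact: bigcup_sub.
  rewrite UE; apply: return_law_approx => // e e0.
  (* Continuity from below supplies the partial union that misses mass at most [e]. *)
  have Zmu : fine (mu (Z n)) @[n --> \oo] --> fine (mu (\bigcup_n Z n)).
    apply: fine_cvg; rewrite fineK ?measure_sub_fin//.
    apply: nondecreasing_cvg_mu => //; apply/nondecreasing_seqP => n.
    by apply/subsetPset; rewrite /Z big_ord_recr; exact: subsetUl.
  have /cvgrPdist_le/(_ _ e0)[N _ /(_ N (leqnn N)) NZ] := Zmu.
  exists (Z N); split=> //; first exact: bigcup_sup.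
  exact: le_trans (ler_norm _) NZ.
- by rewrite -(cyl_systemE Pcof).
Qed.

(** * Reduction of the law to pairs of cylinders of equal level *)

Lemma return_sum_refine n l m f B : measurable B -> (l <= m)%N -> f \in F l ->
  cyl S l f `<=` Y ->
  rs n (cyl S l f) B = \sum_(c <- cfCsum S l m) rs n (cyl S m (f + c)) B.
Proof.
move=> mB lm fF fY; apply/EFin_inj.
have mc k h := measurable_cyl (S := S) k h.
have subY c : c \in cfCsum S l m -> cyl S m (f + c) `<=` Y.
  by move=> cC; apply: subset_trans fY => p; exact: (cyl_coarsen lm fF cC).
rewrite return_sumE//; last exact: measure_sub_ltry.
rewrite -sumEFin [RHS]big_seq.
rewrite [RHS](eq_bigr (fun c => sumE n (cyl S m (f + c)%R) B)); last first.
  move=> c cC; rewrite return_sumE//.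
  exact: measure_sub_ltry (mc _ _) (subY _ cC).
rewrite -big_seq exchange_big /=; apply: eq_bigr => g _.
rewrite setIC (measure_cyl_refine mu (measurable_image_action g mB) lm fF).
by apply: eq_bigr => c _; rewrite setIC.
Qed.

Lemma fine_measure_refine l m f : (l <= m)%N -> f \in F l ->
  fine (mu (cyl S l f)) = \sum_(c <- cfCsum S l m) fine (mu (cyl S m (f + c))).
Proof.
move=> lm fF; have -> : mu (cyl S l f) =
    (\sum_(c <- cfCsum S l m) mu (cyl S m (f + c)%R))%E.
  rewrite -{1}(setTI (cyl S l f)) (measure_cyl_refine mu measurableT lm fF).
  by apply: eq_bigr => c _; rewrite setTI.
rewrite big_seq [RHS]big_seq.
rewrite (eq_bigr (fun c => (fine (mu (cyl S m (f + c)%R)))%:E)); last first.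
  by move=> c cC; rewrite (measure_cylE (cfCsum_FP lm fF cC)).
by rewrite sumEFin.
Qed.

Lemma return_law_cyl_refine l m f B : measurable B -> (l <= m)%N -> f \in F l ->
  cyl S l f `<=` Y ->
  (forall c, c \in cfCsum S l m -> return_law (cyl S m (f + c)) B) ->
  return_law (cyl S l f) B.
Proof.
move=> mB lm fF fY lc; rewrite /return_law (fine_measure_refine lm fF) mulr_suml.
rewrite (_ : return_ratio mu (cyl S l f) B =
  fun n => \sum_(c <- cfCsum S l m | c \in cfCsum S l m)
    return_ratio mu (cyl S m (f + c)) B n); last first.
  apply/funext => n; rewrite return_ratioE (return_sum_refine _ mB lm fF fY).
  by rewrite mulr_suml [LHS]big_seq.
rewrite big_seq.
apply: cvg_big => [|c cC]; [exact: add_continuous|exact: lc].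
Qed.

(** The law is extended in one argument at a time, with [return_lawC] exchanging the two. *)
Lemma return_law_all :
  (forall n a a', a \in cfCsum S 0 n -> a' \in cfCsum S 0 n ->
     return_law (cyl S n a) (cyl S n a')) ->
  forall A B, measurable A -> measurable B -> A `<=` Y -> B `<=` Y ->
    return_law A B.
Proof.
move=> lcyl; have F0 := cfF0_0 S; have mc k h := measurable_cyl (S := S) k h.
have cyl_mem0 m f : cyl S m f !=set0 -> cyl S m f `<=` Y -> f \in cfCsum S 0 m.
  by move=> [p pf] fY; exact: cyl_cfCsum0 (fY _ pf) pf.
(* For different levels the coarser cylinder is cut into pieces of the finer level [m]. *)
have cyl_law l m a f : a \in cfCsum S 0 l -> (l <= m)%N -> cyl S m f `<=` Y ->
    return_law (cyl S m f) (cyl S l a).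
  move=> aA lm fY; have [f0|f0] := eqVneq (cyl S m f) set0.
    by rewrite f0; exact: return_law0.
  apply: return_lawC; [exact: mc|exact: mc|].
  have fA : f \in cfCsum S 0 m by apply: cyl_mem0 => //; exact/set0P.
  apply: (return_law_cyl_refine (mc _ _) lm).
  - exact: cfCsum0_F.
  - exact: cfCsum0_sub.
  - move=> c cC; apply: lcyl => //.
    have cF : a + c \in F m by apply: cfCsum_FP cC => //; exact: cfCsum0_F.
    have [p pc] := cyl_nonempty cF.
    have pa := cyl_coarsen lm (cfCsum0_F aA) cC pc.
    exact: cyl_cfCsum0 (cfCsum0_sub aA pa) pc.
have Ycyl l a : a \in cfCsum S 0 l -> return_law Y (cyl S l a).
  move=> aA; apply: (return_law_cyl_refine (mc _ _) (leq0n l) F0) => // c cC.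
  by apply: cyl_law => //; rewrite add0r; exact: cfCsum0_sub.
have Acyl l a A : a \in cfCsum S 0 l -> measurable A -> A `<=` Y ->
    return_law A (cyl S l a).
  move=> aA; apply: (return_law_extend (l := l)) => //.
  - exact: cfCsum0_sub.
  - exact: Ycyl.
  - by move=> m f lm fY; exact: cyl_law.
have Y0 : 0 \in cfCsum S 0 0 by rewrite cfCsum_geq// inE.
move=> A B mA mB AY BY.
apply: return_lawC => //.
apply: (return_law_extend (l := 0)) => //.
  by apply: return_lawC => //; exact: (Acyl 0%N 0).
move=> m f _ fY; have [f0|f0] := eqVneq (cyl S m f) set0.
  by rewrite f0; exact: return_law0.
apply: return_lawC => //; apply: Acyl => //.
by apply: cyl_mem0 => //; exact/set0P.
Qed.

(** * The equivalent conditions *)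

Hypothesis F_zero : forall n, (0 < n)%N -> 0 \in F n.

Lemma cfF_0 n : 0 \in F n.
Proof. by case: n => [|n]; [exact: cfF0_0|exact: F_zero]. Qed.

(** [[a]_l] and [[a']_l] are the translates of [[0]_l] by [a] and [a'], so invariance moves both to
    [[0]_l] at the cost of shifting [g] by [a' - a]. *)
Lemma return_sum_translate n l a a' : a \in F l -> a' \in F l ->
  rs n (cyl S l a) (cyl S l a') =
  return_sum mu T (translate (a' - a) (E n)) (cyl S l 0) (cyl S l 0).
Proof.
move=> aF a'F; rewrite /return_sum /translate big_imfset/=; last first.
  by move=> g g' _ _ /addrI.
apply: eq_bigr => g _; congr (fine _).
have mc k h := measurable_cyl (S := S) k h.
rewrite -(muT a); last first.
  by apply: measurableI => //; exact: measurable_image_action.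
have aE : T a @^-1` cyl S l a = cyl S l 0.
  by have := @preimage_cyl _ S F_absorb a l 0; rewrite addr0 => ->//; exact: cfF_0.
have a'E : T (- a') @^-1` cyl S l 0 = cyl S l a'.
  by have := @preimage_cyl _ S F_absorb (- a') l a'; rewrite addNr => ->//; exact: cfF_0.
rewrite preimage_setI aE; congr (mu (_ `&` _)).
rewrite !imT -a'E; apply/seteqP; split=> p /=;
  rewrite -!(cf_actionD F_absorb) !opprD !opprK;
  by rewrite [- a' + a - g]addrAC -addrA.
Qed.

Lemma zero_diffset n : 0 \in E n.
Proof.
by apply/diffsetP; exists 0, 0; rewrite subr0; split=> //; exact: cfF_0.
Qed.

Lemma return_sum_gt0 (H : {fset G}) l : 0 \in H ->
  0 < return_sum mu T H (cyl S l 0) (cyl S l 0).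
Proof.
move=> H0; rewrite /return_sum (big_fsetD1 0)//= ltr_wpDr//.
  by rewrite sumr_ge0.
rewrite imT oppr0 (_ : T 0 @^-1` _ = cyl S l 0); last first.
  by apply/seteqP; split=> p /=; rewrite cf_action0.
by rewrite setIid measure_cylE ?cfF_0//= invr_gt0 card_cfCsum0_gt0.
Qed.

(** After division by the return sum [z] of [[0]_l], each pair of level-[l] cylinders in [Y] tends
    to 1, hence the pair [Y], [Y] tends to the number [alpha l ^ 2] of such pairs. The quotient is
    the product of the two measures. *)
Lemma condition_ii_law : condition_ii mu ->
  forall n a a', a \in cfCsum S 0 n -> a' \in cfCsum S 0 n ->
    return_law (cyl S n a) (cyl S n a').
Proof.
(* Condition (ii) concerns positive levels. At level 0 both cylinders are [Y] and the ratio is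
   constantly 1. *)
move=> cii [|l] a a' aA a'A.
  move: aA a'A; rewrite cfCsum_geq// !inE => /eqP -> /eqP ->.
  rewrite /return_law muY mulr1; under eq_fun => n.
    by rewrite return_ratioE divff ?gt_eqF ?return_sum_YY_gt0//; over.
  exact: cvg_cst.
have mc k h := measurable_cyl (S := S) k h.
move: l {cii}(cii l.+1 ^~ (ltn0Sn l)) aA a'A => l'.
set l := l'.+1 => cii aA a'A.
pose z n := return_sum mu T (E n) (cyl S l 0) (cyl S l 0).
have z0 n : z n != 0 by rewrite gt_eqF// return_sum_gt0// zero_diffset.
pose r c c' n := rs n (cyl S l c) (cyl S l c') / z n.
have r1 c c' : c \in cfCsum S 0 l -> c' \in cfCsum S 0 l ->
    r c c' n @[n --> \oo] --> (1 : R).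
  move=> cA c'A; have [cF c'F] := (cfCsum0_F cA, cfCsum0_F c'A).
  rewrite /r; under eq_fun do rewrite return_sum_translate//.
  by apply: cii; apply/diffsetP; exists c', c.
have YE n : rs n Y Y / z n =
    \sum_(c <- cfCsum S 0 l | c \in cfCsum S 0 l)
      \sum_(c' <- cfCsum S 0 l | c' \in cfCsum S 0 l) r c' c n.
  rewrite (return_sum_refine _ (mc _ _) (leq0n l) (cfF_0 0))//.
  rewrite mulr_suml [LHS]big_seq; apply: eq_bigr => c cA.
  rewrite add0r return_sumC//; try exact: mc.
  rewrite (return_sum_refine _ (mc _ _) (leq0n l) (cfF_0 0))//.
  rewrite mulr_suml [LHS]big_seq; apply: eq_bigr => c' c'A.
  by rewrite add0r.
have Ycvg : rs n Y Y / z n @[n --> \oo] --> ((alpha l)%:R * (alpha l)%:R : R).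
  have sum1 (x : R) :
      \sum_(c <- cfCsum S 0 l | c \in cfCsum S 0 l) x = (alpha l)%:R * x.
    by rewrite -big_seq big_const_seq count_predT iter_addr_0 mulr_natl.
  under eq_fun do rewrite YE.
  have -> : (alpha l)%:R * (alpha l)%:R =
    \sum_(c <- cfCsum S 0 l | c \in cfCsum S 0 l)
      \sum_(c' <- cfCsum S 0 l | c' \in cfCsum S 0 l) (1 : R).
    by under eq_bigr do rewrite sum1; rewrite sum1 mulr1.
  apply: cvg_big => [|c cA]; first exact: add_continuous.
  by apply: cvg_big => [|c' c'A]; [exact: add_continuous|exact: r1].
rewrite /return_law (_ : return_ratio mu _ _ =
    fun n => r a a' n / (rs n Y Y / z n)); last first.
  apply/funext => n; rewrite return_ratioE /r invf_div mulrA.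
  by rewrite mulfVK.
rewrite !measure_cylE ?cfCsum0_F//= -invfM -[X in _ --> X]mul1r.
apply: cvgM; first exact: r1.
by apply: cvgV => //; rewrite mulf_neq0// gt_eqF// card_cfCsum0_gt0.
Qed.

(** [cfCsum] unfolds at its left end; the right end is reached through a point of the cylinder over
    [c + c'], which lies in [[0]_l] and is refined from there. *)
Lemma cfCsum_rcons l m c c' : (l <= m)%N -> c \in cfCsum S l m ->
  c' \in C m.+1 -> c + c' \in cfCsum S l m.+1.
Proof.
move=> lm cC c'C; have cF : c \in F m.
  by rewrite -(add0r c); exact: cfCsum_FP lm (cfF_0 l) cC.
have ccF : c + c' \in F m.+1.
  by apply: (fsubsetP (cfFC_sub S m)); apply/imfset2P; exists c => //; exists c'.
have [p pc] := cyl_nonempty ccF; have pm := cyl_coarsen1 cF c'C pc.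
have pl : cyl S l 0 p.
  by apply: (cyl_coarsen lm (cfF_0 l) cC); rewrite add0r.
have [c'' c''C pc''] := cyl_refine (leqW lm) pl.
by rewrite (cyl_uniq pc pc'') add0r.
Qed.

Lemma convolutionE (B : {fset G}) x :
  convolution (nu B) (nu (oppset B)) x =
  \sum_(y <- B) (y - x \in B)%:R :> R.
Proof.
have nuE (D : {fset G}) y : nu D y = (y \in D)%:R :> R.
  rewrite /nu /point_mass; have [yD|yD] := boolP (y \in D).
    rewrite (big_fsetD1 y)//= eqxx big_seq big1 ?addr0// => g.
    by rewrite !inE eq_sym => /andP[/negbTE ->].
  rewrite big_seq big1// => g gD; case: eqP => // yg.
  by rewrite yg gD in yD.
rewrite /convolution -(fsbig_widen [set` B] setT)//; last first.
  by move=> y [_ /= /negP/negbTE yB]; rewrite nuE yB mul0r.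
rewrite -fsbig_seq ?fset_uniq//.
rewrite big_seq [RHS]big_seq; apply: eq_bigr => y yB; rewrite !nuE yB mul1r.
congr (_%:R); congr nat_of_bool; apply/imfsetP/idP => /= [[b bB e]|h].
  by rewrite -opprB e opprK.
by exists (y - x) => //; rewrite opprB.
Qed.

(** At level [L] the convolution counts the cylinders already seen to lie in the intersection, each
    of measure [1 / alpha L]; their unions increase to the whole intersection. *)
Lemma convolution_cvg l g :
  convolution (nu (cfCsum S l L)) (nu (oppset (cfCsum S l L))) g /
    (alpha L)%:R @[L --> \oo] --> fine (mu (cyl S l 0 `&` T g @` cyl S l 0)).
Proof.
pose B L := cfCsum S l L; have mc k h := measurable_cyl (S := S) k h.
(* The points whose level-[L] head [y] and its translate [y - g] both lie in
   [C_{l+1} + ... + C_L]. *)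
pose W L : set (cf_space S) :=
  \bigcup_(y in [set` B L]) (if y - g \in B L then cyl S L y else set0).
have muW L : (l <= L)%N ->
    mu (W L) = (convolution (nu (B L)) (nu (oppset (B L))) g / (alpha L)%:R)%:E.
  move=> lL; rewrite measure_fin_bigcup//.
  - rewrite -fsbig_seq ?fset_uniq// convolutionE mulr_suml -sumEFin.
    rewrite big_seq [RHS]big_seq; apply: eq_bigr => y yB.
    case: ifP => _; last by rewrite measure0 mulr0n mul0r.
    rewrite mulr1n mul1r; apply: measure_cylE.
    by rewrite -(add0r y); exact: cfCsum_FP lL (cfF_0 l) yB.
  - move=> y y' _ _ [p []]; case: ifP => // _ py; case: ifP => // _ py'.
    exact: cyl_uniq py py'.
  - by move=> y _; case: ifP => _; [exact: mc|exact: measurable0].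
have WS L : (l <= L)%N -> W L `<=` W L.+1.
  move=> lL p [y /= yB]; case: ifP => // ygB /cyl_refine1[c cC pc].
  exists (y + c) => /=; first exact: cfCsum_rcons.
  by rewrite addrAC cfCsum_rcons.
have WE : \bigcup_k W (k + l)%N = cyl S l 0 `&` T g @` cyl S l 0.
  rewrite imT; apply/seteqP; split=> p.
    move=> [k _ [y /= yB]]; case: ifP => // ygB py; split.
      by apply: (cyl_coarsen (leq_addl k l) (cfF_0 l) yB); rewrite add0r.
    have ygF : y - g \in F (k + l).
      by rewrite -(add0r (_ - _)); exact: cfCsum_FP (leq_addl k l) (cfF_0 l) ygB.
    apply: (cyl_coarsen (leq_addl k l) (cfF_0 l) ygB); rewrite add0r addrC.
    by apply: cyl_action => //; rewrite addrC.
  (* From level [N] on, [T (- g)] acts on the head of [p], so membership of the image in [[0]_l] can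
     be read off from [y - g]. *)
  move=> [pl /= gpl]; have [N NF] := cyl_absorb F_absorb (- g) p.
  have lN : (l <= N + l)%N by rewrite leq_addl.
  have [y yB py] := cyl_refine lN pl; rewrite add0r in py.
  exists N => //; exists y => //=.
  have pyg := cyl_action py (NF _ _ (leq_addr l N) py).
  have [c cB pc] := cyl_refine lN gpl; rewrite add0r in pc.
  by rewrite addrC (cyl_uniq pyg pc) cB.
have mW k : measurable (W (k + l)%N).
  apply: fin_bigcup_measurable => // y _.
  by case: ifP => _; [exact: mc|exact: measurable0].
rewrite -(cvg_shiftn l) /=.
rewrite (_ : (fun n => _) = fun k => fine (mu (W (k + l)%N))); last first.
  by apply/funext => k; rewrite muW// leq_addl.
rewrite -WE; apply: fine_cvg; rewrite fineK; last first.
  rewrite WE ge0_fin_numE//; apply: (@le_lt_trans _ _ (mu (cyl S l 0))).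
    apply: le_measure; rewrite ?inE; [|exact: mc|exact: subIsetl].
    by apply: measurableI => //; exact: measurable_image_action.
  by rewrite measure_cylE ?cfF_0// ltry.
apply: nondecreasing_cvg_mu => //; first exact: bigcupT_measurable.
apply/nondecreasing_seqP => k; apply/subsetPset; rewrite addSn.
by apply: WS; exact: leq_addl.
Qed.

Lemma condition_iii_ii : condition_iii R S -> condition_ii mu.
Proof.
move=> ciii; rewrite /condition_ii; cbv zeta => l h l0 hF.
have [b [bn b1]] := ciii l h l0 hF.
pose s n := return_sum mu T (E n) (cyl S l 0) (cyl S l 0).
pose sh n := return_sum mu T (translate h (E n)) (cyl S l 0) (cyl S l 0).
pose m L : G -> R := convolution (nu (cfCsum S l L)) (nu (oppset (cfCsum S l L))).
have mass_cvg (H : {fset G}) : mass (m L) H / (alpha L)%:R @[L --> \oo] -->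
    return_sum mu T H (cyl S l 0) (cyl S l 0).
  rewrite /mass /return_sum; under eq_fun do rewrite mulr_suml.
  by apply: cvg_big => [|g _]; [exact: add_continuous|exact: convolution_cvg].
have hE n : (l <= n)%N -> h \in E n.
  move=> /subnK <-; elim: (n - l)%N => [//|k]; rewrite addSn.
  exact: (fsubsetP (diffsetS S _)).
(* For [n >= l] the translate by [h] contains 0, because [- h] lies in [F n - F n]; the limit of the
   denominators is thus nonzero. *)
have sh0 n : (l <= n)%N -> 0 < sh n.
  move=> ln; apply: return_sum_gt0; apply/imfsetP; exists (- h).
    by rewrite diffset_opp hE.
  by rewrite addrN.
(* Normalising both masses by [alpha L] shows that the inner limit [b n] is [s n / sh n], the
   inverse of the ratio in (ii). *)
have bE n : (l <= n)%N -> sh n / s n = (b n)^-1.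
  move=> ln; rewrite -invf_div; congr (_^-1).
  have sn : mass (m L) (E n) / mass (m L) (translate h (E n)) @[L --> \oo] -->
      s n / sh n.
    rewrite (_ : (fun L => _) = fun L => (mass (m L) (E n) / (alpha L)%:R) /
        (mass (m L) (translate h (E n)) / (alpha L)%:R)).
      by apply: cvgM => //; apply: cvgV => //; rewrite gt_eqF// sh0.
    apply/funext => L; rewrite invf_div mulrA mulfVK//.
    by rewrite gt_eqF// card_cfCsum0_gt0.
  by rewrite -(cvg_lim _ sn)// (cvg_lim _ (bn n)).
have : (b n)^-1 @[n --> \oo] --> (1 : R).
  by rewrite -[X in _ --> X]invr1; apply: cvgV => //; exact: oner_neq0.
apply: cvg_trans; apply: near_eq_cvg; near=> n; rewrite -bE//.
by near: n; exact: nbhs_infty_ge.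
Unshelve. all: by end_near.
Qed.

Lemma condition_1_law : condition_i mu \/ condition_ii mu \/ condition_iii R S ->
  forall A B, measurable A -> measurable B -> A `<=` Y -> B `<=` Y ->
    return_law A B.
Proof.
move=> H1; apply: return_law_all; case: H1 => [ci n a a' aA a'A|H1].
  apply: ci; try exact: cfCsum0_sub.
  - by exists n, [fset a]%fset; rewrite fsub1set cfCsum0_F.
  - by exists n, [fset a']%fset; rewrite fsub1set cfCsum0_F.
by apply: condition_ii_law; case: H1 => // /condition_iii_ii.
Qed.

(** * Ergodicity and non-squashability *)

(** An enumeration of the translates of [Y], which cover the space; numbers that encode no group
    element give the empty set. *)
Definition visiting k : set (cf_space S) :=
  if choice.unpickle k is Some h then T h @^-1` Y else set0.

Lemma bigcup_visiting : \bigcup_k visiting k = setT.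
Proof.
apply/seteqP; split=> // p _; have [n [f pf]] := cyl_ex p.
have [q qY] := cyl_nonempty (cfF0_0 S).
have [a qa] := cyl_level_ge (leq0n n) qY.
exists (choice.pickle (a - f)) => //; rewrite /visiting choice.pickleK.
apply: (cfCsum0_sub (cyl_cfCsum0 qY qa)).
have := @cyl_action _ S (a - f) _ _ _ pf; rewrite subrK; apply.
exact: cyl_mem qa.
Qed.

Lemma measurable_visiting k : measurable (visiting k).
Proof.
rewrite /visiting; case: choice.unpickle => [h|]; last exact: measurable0.
by apply: mT; exact: measurable_cyl.
Qed.

Lemma null_of_visits A : measurable A ->
  (forall h, mu (A `&` T h @^-1` Y) = 0%E) -> mu A = 0%E.
Proof.
move=> mA A0; rewrite -(setIT A) -bigcup_visiting setI_bigcupr.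
apply: measure_negligible.
  apply: bigcupT_measurable => k; apply: measurableI => //.
  exact: measurable_visiting.
apply: negligible_bigcup => k.
apply/negligibleP.
  by apply: measurableI => //; exact: measurable_visiting.
rewrite /visiting; case: choice.unpickle => [h|]; first exact: A0.
by rewrite setI0 measure0.
Qed.

Lemma sigma_finite_cf : sigma_finite setT mu.
Proof.
exists visiting; first by rewrite bigcup_visiting.
move=> k; split; first exact: measurable_visiting.
rewrite /visiting; case: choice.unpickle => [h|]; last by rewrite measure0 ltry.
by rewrite muT ?muY ?ltry//; exact: measurable_cyl.
Qed.

Lemma mp_action_cf : mp_action mu T.
Proof.
split; [exact: cf_action0|exact: cf_actionD| |by move=> g A; exact: muT].
by move=> g; exact: measurable_cf_action.
Qed.

Section Ergodicity.
Hypothesis law : forall A B, measurable A -> measurable B ->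
  A `<=` Y -> B `<=` Y -> return_law A B.

(* The normalising sum is at least [alpha n], hence unbounded. *)
Lemma bounded_return_sum_null A B (M : R) : measurable A -> measurable B ->
  A `<=` Y -> B `<=` Y -> (forall n, rs n A B <= M) ->
  mu A = 0%E \/ mu B = 0%E.
Proof.
move=> mA mB AY BY AM.
have M0 : 0 <= M by apply: le_trans (AM 0%N); exact: return_sum_ge0.
have r0 : return_ratio mu A B n @[n --> \oo] --> (0 : R).
  (* [harmonic n] is [1 / (n + 1)], and the normalising sum is at least [alpha n >= n + 1]. *)
  have h0 : M * harmonic n @[n --> \oo] --> (0 : R).
    by rewrite -(mulr0 M); apply: cvgM; [exact: cvg_cst|exact: cvg_harmonic].
  apply: (squeeze_cvgr _ (cvg_cst (0 : R)) h0).
  apply: nearW => n; rewrite return_ratio_ge0/= return_ratioE.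
  apply: ler_pM => //; rewrite ?return_sum_ge0 ?invr_ge0 ?return_sum_ge0//.
  rewrite lef_pV2 ?posrE ?return_sum_YY_gt0//.
  by apply: le_trans (return_sum_YY n); rewrite ler_nat card_cfCsum0_gt.
have : fine (mu A) * fine (mu B) = 0.
  by rewrite -(cvg_lim _ (law mA mB AY BY))// (cvg_lim _ r0).
move=> /eqP; rewrite mulf_eq0 => /orP[] /eqP e; [left|right];
  by rewrite -[LHS]fineK ?measure_sub_fin// e.
Qed.

(** For invariant [A] no translate of its complement meets it, so all return sums between the two
    traces on [Y] vanish. By the law one trace is null, and invariance spreads this over the
    translates of [Y]. *)
Lemma ergodic_cf : ergodic mu T.
Proof.
move=> A mA AT; have mY := measurable_cyl (S := S) 0 0.
have nAT g : T g @^-1` (~` A) = ~` A by rewrite -preimage_setC AT.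
have mnA := measurableC mA.
have vanish D : measurable D -> (forall g, T g @^-1` D = D) ->
    mu (D `&` Y) = 0%E -> mu D = 0%E.
  move=> mD DT DY0; apply: null_of_visits => // h.
  by rewrite -{1}(DT h) -preimage_setI muT//; exact: measurableI.
have : mu (A `&` Y) = 0%E \/ mu (~` A `&` Y) = 0%E.
  apply: (bounded_return_sum_null (M := 0));
    [exact: measurableI|exact: measurableI|exact: subIsetr|exact: subIsetr|].
  move=> n; rewrite /return_sum big1// => g _.
  rewrite (_ : _ `&` _ = set0) ?measure0//.
  apply/seteqP; split=> // p [[Ap _] [q [Aq _] qp]].
  by have := AT g; move=> /(congr1 (@^~ q)) /= e; apply: Aq; rewrite -e qp.
by case=> [/vanish|/vanish] h; [left|right]; exact: h.
Qed.

(** If [A] met all its nontrivial translates in null sets, the return sums of a piece of it moved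
    into [Y] would reduce to the term [g = 0] and stay bounded by 1, forcing that piece to be
    null. *)
Lemma conservative_cf : conservative mu T.
Proof.
move=> A mA A0; have mY := measurable_cyl (S := S) 0 0.
apply: contrapT => no.
have no' g : g != 0 -> mu (A `&` T g @` A) = 0%E.
  move=> g0; apply/eqP; rewrite -measure_le0 leNgt; apply/negP => h.
  by apply: no; exists g.
suff : mu A = 0%E by move=> Az; rewrite Az ltxx in A0.
apply: null_of_visits => // h.
pose D := T (- h) @^-1` A `&` Y.
have mD : measurable D by apply: measurableI => //; exact: mT.
have DE : T h @^-1` D = A `&` T h @^-1` Y.
  rewrite preimage_setI; congr (_ `&` _).
  by apply/seteqP; split=> p /=; rewrite cf_actionNK.
rewrite -DE muT//.
have DY : D `<=` Y by exact: subIsetr.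
suff : mu D = 0%E \/ mu D = 0%E by case.
apply: (bounded_return_sum_null (M := 1)) => // n.
rewrite /return_sum (big_fsetD1 0) ?zero_diffset//=.
rewrite [X in _ + X]big_seq [X in _ + X]big1 ?addr0.
  rewrite -[leRHS]/(fine (1%:E : \bar R)) -muY.
  have mDD : measurable (D `&` T 0 @` D).
    by apply: measurableI => //; exact: measurable_image_action.
  have DDY : D `&` T 0 @` D `<=` Y by apply: subset_trans DY; exact: subIsetl.
  apply: fine_le; rewrite ?measure_sub_fin//.
  by apply: le_measure; rewrite ?inE.
move=> g; rewrite !inE => /andP[g0 _].
suff -> : mu (D `&` T g @` D) = 0%E by [].
apply/eqP; rewrite -measure_le0 -(no' _ g0) -(muT (- h)); last first.
  by apply: measurableI => //; exact: measurable_image_action.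
apply: le_measure; rewrite ?inE; last first.
- move=> p [[Ap _] [q [Aq _] qp]]; split => //=; exists (T (- h) q) => //.
  by rewrite -qp -!(cf_actionD F_absorb) addrC.
- by apply: mT; apply: measurableI => //; exact: measurable_image_action.
- by apply: measurableI => //; exact: measurable_image_action.
Qed.

Lemma weakly_rationally_ergodic_cf : weakly_rationally_ergodic mu T (fun n => E n).
Proof.
split.
  split; [exact: sigma_finite_cf|exact: mp_action_cf|exact: ergodic_cf|
    exact: conservative_cf|exact: diffsetS].
exists Y; rewrite muY; split; [exact: measurable_cyl|by rewrite lte01|by rewrite ltry|].
move=> A B mA mB AY BY; rewrite /= expr1n; under eq_fun do rewrite divr1 mulrC.
exact: law.
Qed.

End Ergodicity.

(** * Nonsingular transformations commuting with the action *)

Lemma measure_ae_eq A B : measurable A -> measurable B ->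
  {ae mu, forall p, A p <-> B p} -> mu A = mu B.
Proof.
move=> mA mB AB.
have half D D' : measurable D -> measurable D' ->
    {ae mu, forall p, D p <-> D' p} -> mu D = mu (D `&` D').
  move=> mD mD' DD'; rewrite (measureDI mu mD mD').
  rewrite (measure_negligible _ (_ : mu.-negligible (D `\` D'))) ?add0e//.
    exact: measurableD.
  by apply: negligibleS DD' => p [Dp D'p] /= h; apply: D'p; exact/h.
rewrite (half A B)// (half B A)//; first by rewrite setIC.
by apply: filterS AB => p [].
Qed.

Definition commuting (Q : cf_space S -> cf_space S) :=
  nonsingular mu Q /\ forall g, {ae mu, forall p, Q (T g p) = T g (Q p)}.

Lemma commuting_id : commuting id.
Proof. by split=> [|g]; [split|apply: nearW]. Qed.

Lemma commuting_comp Q Q' : commuting Q -> commuting Q' -> commuting (Q \o Q').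
Proof.
move=> [[mQ nQ] cQ] [[mQ' nQ'] cQ']; split=> [|g].
  split; first exact: measurableT_comp mQ mQ'.
  move=> N mN; have mQN := measurable_preimage mQ mN.
  exact: iff_trans (nQ' _ mQN) (nQ _ mN).
(* Nonsingularity of [Q'] pulls the exceptional null set of [Q] back to a null set. *)
have cQQ' : {ae mu, forall p, Q (T g (Q' p)) = T g (Q (Q' p))}.
  have [N [mN N0 sN]] := cQ g; exists (Q' @^-1` N); split.
  - exact: (measurable_preimage mQ').
  - exact/nQ'.
  - by move=> p /= h; exact: sN.
by apply: filterS2 (cQ' g) cQQ' => p /= -> ->.
Qed.

Lemma commuting_iter Q k : commuting Q -> commuting (iter k Q).
Proof.
move=> cQ; elim: k => [|k ih]; first exact: commuting_id.
exact: (commuting_comp cQ ih).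
Qed.

Lemma measure_preimage_commute Q g A D : commuting Q -> measurable A ->
  measurable D -> mu (D `&` Q @^-1` (T g @^-1` A)) =
                  mu (D `&` T g @^-1` (Q @^-1` A)).
Proof.
move=> [[mQ nQ] cQ] mA mD; apply: measure_ae_eq.
- by apply: measurableI => //; apply: (measurable_preimage mQ); exact: mT.
- by apply: measurableI => //; apply: mT; exact: (measurable_preimage mQ).
- by apply: filterS (cQ g) => p /= ->.
Qed.

Definition cf_X n : set (cf_space S) := \bigcup_(f in [set` F n]) cyl S n f.

Lemma measurable_cf_X n : measurable (cf_X n).
Proof. by apply: fin_bigcup_measurable => // f _; exact: measurable_cyl. Qed.

Lemma cf_XS n : cf_X n `<=` cf_X n.+1.
Proof.
move=> p [f _ pf]; have [c _ pc] := cyl_refine1 pf.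
by exists (f + c) => //; exact: cyl_mem pc.
Qed.

Lemma bigcup_cf_X : \bigcup_n cf_X n = setT.
Proof.
apply/seteqP; split=> // p _; have [n [f pf]] := cyl_ex p.
by exists n => //; exists f => //; exact: cyl_mem pf.
Qed.

(** Continuity from below. It serves for the images of the [X_n] and their preimages under [Q],
    where the lower bound on visits is available. *)
Lemma le_measure_exhaust (Z : nat -> set (cf_space S)) A x : measurable A ->
  (forall n, measurable (Z n)) -> (forall n, Z n `<=` Z n.+1) ->
  \bigcup_n Z n = setT -> (forall n, (mu (A `&` Z n) <= x)%E) -> (mu A <= x)%E.
Proof.
move=> mA mZ ZS ZT Ax; have mAZ n : measurable (A `&` Z n) by exact: measurableI.
have AE : \bigcup_n (A `&` Z n) = A by rewrite -setI_bigcupr ZT setIT.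
have cv : mu (A `&` Z n) @[n --> \oo] --> mu A.
  rewrite -{2}AE; apply: nondecreasing_cvg_mu => //; first by rewrite AE.
  by apply/nondecreasing_seqP => n; apply/subsetPset; apply: setIS; exact: ZS.
rewrite -(cvg_lim _ cv)//; apply: lime_le; first exact: cvgP cv.
exact: nearW.
Qed.

(* The sum [J n] of [mu (Y `&` Q^-1 (T_g^-1 Y))] over [E n] is estimated fibrewise
   over [Y] and over [Q^-1 Y]; in both cases a point contributes between
   [alpha n] and [K ^ 2 * alpha n] values of [g]. *)
Lemma commuting_bounds Q : commuting Q ->
  (mu (Q @^-1` Y) <= (K * K)%:R%:E)%E /\
  (1 <= (K * K)%:R%:E * mu (Q @^-1` Y))%E.
Proof.
move=> cQ; have mQ := cQ.1.1; have mY := measurable_cyl (S := S) 0 0.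
have mQA A : measurable A -> measurable (Q @^-1` A).
  by move=> mA; exact: (measurable_preimage mQ).
pose J n := (\sum_(g <- E n) mu (Y `&` Q @^-1` (T g @^-1` Y)))%E.
have J1 n : (J n <= (K * K * alpha n)%:R%:E * 1)%E.
  rewrite -muY; apply: sum_measureI_le => //.
    by move=> g; apply: mQA; exact: mT.
  by move=> p _; exact: (visits_le F_absorb F_cover n (Q p)).
have J2 n : ((alpha n)%:R%:E * mu (Y `&` Q @^-1` cf_X n) <= J n)%E.
  apply: (@le_trans _ _ (\sum_(g <- E n)
      mu (Y `&` Q @^-1` cf_X n `&` Q @^-1` (T g @^-1` Y)))%E).
    apply: sum_measureI_ge.
    - by move=> g; apply: mQA; exact: mT.
    - by apply: measurableI => //; apply: mQA; exact: measurable_cf_X.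
    - by move=> p [_ [f _ pf]]; exact: (visits_ge pf).
  apply: lee_sum => g _; apply: le_measure; rewrite ?inE.
  - apply: measurableI; last by apply: mQA; exact: mT.
    by apply: measurableI => //; apply: mQA; exact: measurable_cf_X.
  - by apply: measurableI => //; apply: mQA; exact: mT.
  - by apply: setSI; exact: subIsetl.
have JE n : J n = sumE n (Q @^-1` Y) Y.
  apply: eq_bigr => g _; rewrite measure_preimage_commute//.
  have := @measure_translate (- g) Y (Q @^-1` Y) mY (mQA _ mY).
  by rewrite imT opprK => ->.
have a0 n : (0 < (alpha n)%:R%:E :> \bar R)%E by rewrite lte_fin card_cfCsum0_gt0.
have KaE n : ((K * K * alpha n)%:R%:E = (alpha n)%:R%:E * (K * K)%:R%:E :> \bar R)%E.
  by rewrite mulnC natrM EFinM.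
split.
  apply: (le_measure_exhaust (mQA _ mY) measurable_cf_X cf_XS bigcup_cf_X) => n.
  rewrite -(@lee_pmul2l _ (alpha n)%:R%:E)//.
  apply: le_trans (sum_return_ge n (mQA _ mY)) _.
  by rewrite -JE; apply: le_trans (J1 n) _; rewrite mule1 KaE.
rewrite -muY; apply: (le_measure_exhaust (Z := fun n => Q @^-1` cf_X n)) => //.
- by move=> n; apply: mQA; exact: measurable_cf_X.
- by move=> n p; exact: cf_XS.
- by rewrite -preimage_bigcup bigcup_cf_X.
move=> n; rewrite -(@lee_pmul2l _ (alpha n)%:R%:E)//; apply: le_trans (J2 n) _.
rewrite JE; apply: le_trans (sum_return_le n (mQA _ mY)) _.
by rewrite KaE muleA.
Qed.

Lemma commuting_scale Q : commuting Q -> exists c : R,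
  [/\ 0 <= c, c <= (K * K)%:R, 1 <= (K * K)%:R * c &
      forall A, measurable A -> mu (Q @^-1` A) = (c%:E * mu A)%E].
Proof.
move=> cQ; have mQ := cQ.1.1; have [cK Kc] := commuting_bounds cQ.
have mY := measurable_cyl (S := S) 0 0.
have cfin : mu (Q @^-1` Y) \is a fin_num.
  by rewrite ge0_fin_numE//; apply: le_lt_trans cK _; rewrite ltry.
pose c := fine (mu (Q @^-1` Y)); have c0 : 0 <= c by exact: fine_ge0.
have cE : mu (Q @^-1` Y) = c%:E by rewrite fineK.
exists c; split; [by []|by rewrite -lee_fin -cE|by rewrite -lee_fin EFinM -cE|].
move=> A mA; have -> : mu (Q @^-1` A) = pushforward_measure mu mQ A by [].
have -> : (c%:E * mu A)%E = mscale (NngNum c0) mu A by [].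
apply: (invariant_measure_unique F_absorb) => //.
- move=> g B mB; change (mu (Q @^-1` (T g @^-1` B)) = mu (Q @^-1` B)).
  have := measure_preimage_commute g cQ mB measurableT; rewrite !setTI => ->.
  by rewrite muT//; exact: (measurable_preimage mQ).
- by move=> g B mB; congr (_ * _)%E; exact: muT.
- by rewrite /= /pushforward cE ltry.
- by rewrite /= /pushforward cE /mscale /= muY mule1.
Qed.

Lemma not_geometric_ge (M x : R) : 0 <= x -> x < 1 ->
  ~ (forall k, 1 <= M * x ^+ k).
Proof.
move=> x0 x1 h.
have cv : M * x ^+ k @[k --> \oo] --> (0 : R).
  by apply: cvg_geometric; rewrite ger0_norm.
have : 1 <= 0 :> R.
  by rewrite -(cvg_lim _ cv)//; apply: limr_ge; [exact: cvgP cv|exact: nearW].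
by rewrite ler10.
Qed.

(* The constant of [iter k Q] is the [k]-th power of that of [Q], and both are
   bounded by [commuting_bounds]. *)
Lemma non_squashable_cf : non_squashable mu T.
Proof.
move=> Q nsQ aeQ B mB; have cQ : commuting Q by [].
have [c [c0 _ _ cE]] := commuting_scale cQ.
have iterE k A : measurable A -> mu (iter k Q @^-1` A) = ((c ^+ k)%:E * mu A)%E.
  elim: k A => [|k ih] A mA; first by rewrite expr0 mul1e.
  have -> : iter k.+1 Q @^-1` A = iter k Q @^-1` (Q @^-1` A) by [].
  rewrite ih ?cE//; last exact: (measurable_preimage cQ.1.1).
  by rewrite muleA -EFinM -exprSr.
have cb k : c ^+ k <= (K * K)%:R /\ 1 <= (K * K)%:R * c ^+ k.
  have [ck [_ ck1 ck2 ckE]] := commuting_scale (commuting_iter k cQ).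
  have := ckE Y (measurable_cyl _ _); rewrite iterE; last exact: measurable_cyl.
  by rewrite muY !mule1 => -[->].
have cge1 : 1 <= c.
  rewrite leNgt; apply/negP => c1.
  by apply: (@not_geometric_ge (K * K)%:R c) => // k; have [] := cb k.
have cle1 : c <= 1.
  rewrite leNgt; apply/negP => c1; have cp : 0 < c by exact: lt_trans c1.
  (* The upper bound on [c ^+ k] is a lower bound for the powers of [c^-1], so the same argument
     excludes [c > 1]. *)
  apply: (@not_geometric_ge (K * K)%:R c^-1) => [||k].
  - by rewrite invr_ge0.
  - by rewrite invf_lt1.
  - by rewrite exprVn ler_pdivlMr ?exprn_gt0// mul1r; have [] := cb k.
by rewrite cE// (le_anti (_ : c <= 1 <= c)) ?mul1e// cle1.
Qed.

End ReturnSums.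

Theorem corollary2p7 (R : realType) (G : countZmodType)
    (Ginf : infinite_set [set: G])
    (S : cf_sequence G)
    (F_zero : forall n, (0 < n)%N -> 0 \in cfF S n)
    (F_absorb : forall (g : G) n, (0 < n)%N -> exists2 m, (n < m)%N &
       (translate g (sumset (cfF S n) (cfCsum S n m)) `<=` cfF S m)%fset)
    (mu : {measure set (cf_space S) -> \bar R})
    (mu_cf : cf_measure mu)
    (mu_norm : mu (cyl0 S 0) = 1%E)
    (H1 : condition_i mu \/ condition_ii mu \/ condition_iii R S)
    (H2 : condition_2 S) :
  [/\ forall A B : set (cf_space S), measurable A -> measurable B ->
        A `<=` cyl0 S 0 -> B `<=` cyl0 S 0 ->
        return_ratio mu A B n @[n --> \oo] --> fine (mu A) * fine (mu B),
      weakly_rationally_ergodic mu (cf_action S)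
        (fun n => diffset (cfF S n) (cfF S n)) &
      non_squashable mu (cf_action S)].
Proof.
have [_ mu_cyl] := mu_cf; have [K K0 cover] := H2.
have F_cover n : exists d : 'I_K -> G, forall g,
    g \in diffset (cfF S n) (cfF S n) -> exists j, g \in translate (d j) (cfF S n).
  by have [d [_ dE]] := cover n; exists d.
have law := condition_1_law F_absorb mu_cyl mu_norm F_cover F_zero H1.
split; first exact: law.
- exact: (weakly_rationally_ergodic_cf F_absorb mu_cyl mu_norm F_zero law).
- exact: (non_squashable_cf F_absorb mu_cyl mu_norm F_cover).
Qed.
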